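(* Consider the facility location problem on a random shortest path metric on $n$ vertices with opening costs $0<f_1\le\dots\le f_n$ (which may depend on $n$), and assume there is a constant $q$ with $f_n/f_1\le n^q$ for all $n$. Let $F_k=\sum_{i=1}^k f_i$. Define $\kappa:=\max\{i\in[n]: f_i<1/(i-1)\}$ and assume $\kappa\in\Theta(n)$. Let $\mathsf{ALG}$ denote the total cost of the solution which opens, independently of the metric, the facilities with opening costs $f_1,\ldots,f_\kappa$, and let $\mathsf{OPT}$ be the optimal cost. Then $$\mathbb{E}\left[\frac{\mathsf{ALG}}{\mathsf{OPT}}\right]\le\sqrt{\max\left\{\frac1{F_n^2},\max_{k\in[n-1]}O\left(\frac{n^4F_{n-k}+kn^2}{n^4F_{n-k}^3+k^4F_{n-k}}\right)\right\}}+\sqrt[4]{O\left(\frac{n^6F_{n-1}^2+n^2}{n^8F_{n-1}^7+F_{n-1}^3}+\frac{n^{10}F_{n-2}^3+n^4}{n^{14}F_{n-2}^9+F_{n-2}^2}+\sum_{k=3}^{n-1}\frac{k^3n^{12}F_{n-k}^3+k^9n^6}{n^{16}F_{n-k}^9+k^{16}F_{n-k}}\right)}.$$ Moreover, if $\kappa=n$, then $$\mathbb{E}\left[\frac{\mathsf{ALG}}{\mathsf{OPT}}\right]\le F_n\sqrt{\max\left\{\frac1{F_n^2},\max_{k\in[n-1]}O\left(\frac{n^4F_{n-k}+kn^2}{n^4F_{n-k}^3+k^4F_{n-k}}\right)\right\}}+F_n\sqrt[4]{O\left(\frac{n^6F_{n-1}^2+n^2}{n^8F_{n-1}^7+F_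{n-1}^3}+\frac{n^{10}F_{n-2}^3+n^4}{n^{14}F_{n-2}^9+F_{n-2}^2}+\sum_{k=3}^{n-1}\frac{k^3n^{12}F_{n-k}^3+k^9n^6}{n^{16}F_{n-k}^9+k^{16}F_{n-k}}\right)}.$$
   Context: Random shortest path metric: let $G=(V,E)$ be the complete undirected graph on $n$ vertices; each edge $e$ independently receives a weight $w(e)\sim\mathrm{Exp}(1)$ (exponential distribution with rate $1$), and $d(u,v)$ is the minimum total weight of a $u$-$v$ path in $G$. Facility location: vertex $i\in V=[n]$ has opening cost $f_i>0$, the costs are deterministic (independent of the edge weights) and numbered so that $f_1\le\dots\le f_n$. For nonempty $U\subseteq V$, $c(U)=\sum_{i\in U}f_i+\sum_{v\in V}\min_{u\in U}d(u,v)$, and $\mathsf{OPT}=\min_{\emptyset\ne U\subseteq V}c(U)$. In the definition of $\kappa$, $1/(i-1)$ for $i=1$ is interpreted as $+\infty$. $\mathsf{ALG}=c(\{1,\ldots,\kappa\})$. Asymptotic notation refers to $n\to\infty$, where the opening costs are allowed to depend on $n$. *)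

(* Defs.v *)
From HB Require Import structures.
From mathcomp Require Import all_boot all_order all_algebra.
From mathcomp Require Import all_classical all_reals all_analysis.
Set Implicit Arguments. Unset Strict Implicit. Unset Printing Implicit Defensive.
Import Order.TTheory GRing.Theory Num.Theory.
Local Open Scope classical_set_scope.
Local Open Scope ring_scope.

Section FL.
Variable R : realType.

Fixpoint walk_weight n (w : 'I_n -> 'I_n -> R) (x : 'I_n) (p : seq 'I_n) : R :=
  match p with
  | [::] => 0
  | y :: p' => w x y + walk_weight w y p'
  end.

(* d(u,v): minimum total weight of a u-v path in the complete graph on 'I_n
   (paths = sequences of pairwise distinct vertices; the set is finite and
   nonempty, so the infimum is a minimum) *)
Definition sp_dist n (w : 'I_n -> 'I_n -> R) (u v : 'I_n) : R :=
  inf [set x | exists p : seq 'I_n,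
        [/\ uniq (u :: p), last u p = v & x = walk_weight w u p]].

Definition fl_cost n (f : 'I_n -> R) (w : 'I_n -> 'I_n -> R) (U : {set 'I_n}) : R :=
  \sum_(i in U) f i
  + \sum_(v : 'I_n) inf [set sp_dist w u v | u in [set u | u \in U]].

Definition fl_opt n (f : 'I_n -> R) (w : 'I_n -> 'I_n -> R) : R :=
  inf [set fl_cost f w U | U in [set U : {set 'I_n} | (0 < #|U|)%N]].

(* kappa = max{ i in [n] : f_i < 1/(i-1) }, with 1/0 = +oo.  Vertices are
   0-based: vertex j corresponds to index i = j+1. *)
Definition kappa n (f : 'I_n -> R) : nat :=
  \max_(j < n | (j == 0 :> nat) || (f j < (j%:R)^-1)) j.+1.

Definition first_set n (k : nat) : {set 'I_n} := [set j : 'I_n | (j < k)%N].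

Definition Fsum n (f : 'I_n -> R) (k : nat) : R := \sum_(i < n | (i < k)%N) f i.

(* weight of the undirected edge {u,v}, read from the variable indexed by
   the ordered pair (min, max) *)
Definition edge_w n (W : 'I_n * 'I_n -> R) (u v : 'I_n) : R :=
  if (u < v)%N then W (u, v) else W (v, u).

Definition rsp_model d (T : measurableType d) (P : probability T R) n
    (W : 'I_n * 'I_n -> {RV P >-> R}) : Prop :=
  (forall e : 'I_n * 'I_n, (e.1 < e.2)%N ->
     forall A : set R, measurable A ->
       distribution P (W e) A = exponential_prob (1:R) A)
  /\
  (forall (J : {set 'I_n * 'I_n}) (B : 'I_n * 'I_n -> set R),
     (forall e, e \in J -> (e.1 < e.2)%N) ->
     (forall e, measurable (B e)) ->
     P (\bigcap_(e in [set e | e \in J]) (W e @^-1` B e))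
     = (\prod_(e in J) P (W e @^-1` B e))%E).

Definition exp_ratio d (T : measurableType d) (P : probability T R) n
    (f : 'I_n -> R) (W : 'I_n * 'I_n -> {RV P >-> R}) : \bar R :=
  (\int[P]_om
     ((fl_cost f (edge_w (fun e => W e om)) (first_set n (kappa f))
       / fl_opt f (edge_w (fun e => W e om)))%:E))%E.

(* the right-hand side, with a single constant C standing for the O's;
   F k stands for F_k *)
Definition termA (n k : nat) (F : nat -> R) : R :=
  let Fk := F (n - k)%N in
  (n%:R ^+ 4 * Fk + k%:R * n%:R ^+ 2) / (n%:R ^+ 4 * Fk ^+ 3 + k%:R ^+ 4 * Fk).

Definition termB (n : nat) (F : nat -> R) : R :=
  let F1 := F (n - 1)%N in
  let F2 := F (n - 2)%N in
  (n%:R ^+ 6 * F1 ^+ 2 + n%:R ^+ 2) / (n%:R ^+ 8 * F1 ^+ 7 + F1 ^+ 3)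
  + (n%:R ^+ 10 * F2 ^+ 3 + n%:R ^+ 4) / (n%:R ^+ 14 * F2 ^+ 9 + F2 ^+ 2)
  + \sum_(3 <= k < n)
      (let Fk := F (n - k)%N in
       (k%:R ^+ 3 * n%:R ^+ 12 * Fk ^+ 3 + k%:R ^+ 9 * n%:R ^+ 6)
       / (n%:R ^+ 16 * Fk ^+ 9 + k%:R ^+ 16 * Fk)).

Definition rhs_bound (C : R) (n : nat) (F : nat -> R) : R :=
  Num.sqrt (Num.max ((F n ^+ 2)^-1)
                    (\big[Num.max/0]_(1 <= k < n) (C * termA n k F)))
  + Num.sqrt (Num.sqrt (C * termB n F)).

End FL.

(* Main.v *)
(* If a solution leaves [k] facilities closed, it costs at least [F_(n-k)] plus
   the connection of [k] vertices; along a shortest-path forest these use [k]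
   distinct edges, so the connection cost is at least the sum of the [k]
   smallest edge weights, typically of order [k^2 / n^2].  Since [F_(n-k)]
   decreases in [k] and [k^2 / n^2] increases, only the crossover index [k0]
   matters, and [OPT] is of order [tau = k0^2 / n^2].  A third factorial moment
   of the number of short edges gives [P(OPT < s) = O((n^2 s / k0^2)^3)], which
   is enough to control [E[OPT^-2; OPT < tau]]; for [k = 1, 2] the
   singularity is cut off by the opening costs [F_(n-1)], [F_(n-2)].  As
   [E[ALG^2] = O(1)] when [kappa] is linear in [n], AM-GM bounds [E[ALG / OPT]]
   by the [termA] part.  When [F_n <= 1/n^2] all facilities are opened,
   [tau = F_n] gives the term [1 / F_n] with constant exactly 1, and the event
   [OPT < F_n] is paid for by [termB]. *)
Require Import Defs.
From HB Require Import structures.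
From mathcomp Require Import all_boot all_order all_algebra.
From mathcomp Require Import all_classical all_reals all_analysis.
From mathcomp Require Import measurable_realfun ring lra zify.
Set Implicit Arguments. Unset Strict Implicit. Unset Printing Implicit Defensive.
Import Order.TTheory GRing.Theory Num.Theory.
Local Open Scope classical_set_scope.
Local Open Scope ring_scope.

(** * Upper bounds on expectations *)

Section UpperExpectation.
Context (d : measure_display) (T : measurableType d) (R : realType).
Variable P : probability T R.
Implicit Types (h : T -> R) (c : R) (g : T -> \bar R).

(* [h] is not required to be measurable: an integrable majorant suffices, so
   the measurability of shortest-path distances never has to be established. *)
Definition uexp h c : Prop := exists g : T -> \bar R,
  [/\ measurable_fun setT g, (forall x, 0 <= g x)%E,
      (forall x, (h x)%:E <= g x)%E & (\int[P]_x g x <= c%:E)%E].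

(** The negative part of [h] only lowers the integral. That of the positive part is a supremum over
    simple functions, each of which also lies below [g]. *)
Lemma integral_le_uexp h c : uexp h c -> (\int[P]_x (h x)%:E <= c%:E)%E.
Proof.
move=> [g [mg g0 hg gc]]; apply: le_trans gc.
have hg' x : ((EFin \o h)^\+ x <= g x)%E.
  by rewrite funeposE ge_max hg g0.
rewrite integralE.
apply: (@le_trans _ _ (\int[P]_x (EFin \o h)^\+ x)%E).
  by rewrite geeDl// oppe_le0 integral_ge0.
rewrite (ge0_integralTE _ g0) ge0_integralTE//.
apply: le_ereal_sup => _ [s hs <-]; exists s => // x.
exact: le_trans (hs x) (hg' x).
Qed.

Lemma uexp_le h' c' h c : uexp h' c' -> (forall x, h x <= h' x) -> c' <= c ->
  uexp h c.
Proof.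
move=> [g [mg g0 hg gc]] hh cc; exists g; split=> // [x|].
  by apply: le_trans (hg x); rewrite lee_fin.
by apply: le_trans gc _; rewrite lee_fin.
Qed.

Lemma uexp_indic (A : set T) c : measurable A -> (P A <= c%:E)%E ->
  uexp (\1_A) c.
Proof.
move=> mA Ac; exists (EFin \o \1_A); split=> //.
- exact/measurable_EFinP/measurable_indic.
- by move=> x; rewrite lee_fin.
- by rewrite integral_indic// setIT.
Qed.

Lemma uexp_cst c : 0 <= c -> uexp (fun=> c) c.
Proof.
move=> c0; exists (cst c%:E); split=> //.
by rewrite integral_cst// [X in (_ * X)%E](probability_setT P) mule1.
Qed.

Lemma uexpD h1 c1 h2 c2 : uexp h1 c1 -> uexp h2 c2 ->
  uexp (fun x => h1 x + h2 x) (c1 + c2).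
Proof.
move=> [g1 [m1 p1 l1 i1]] [g2 [m2 p2 l2 i2]].
exists (fun x => g1 x + g2 x)%E; split.
- exact: emeasurable_funD.
- by move=> x; exact: adde_ge0.
- by move=> x; rewrite EFinD leeD.
- by rewrite ge0_integralD// EFinD leeD.
Qed.

Lemma uexpZ a h c : 0 <= a -> uexp h c -> uexp (fun x => a * h x) (a * c).
Proof.
move=> a0 [g [m p l i]].
exists (fun x => a%:E * g x)%E; split.
- exact: measurable_funeM.
- by move=> x; rewrite mule_ge0.
- by move=> x; rewrite EFinM lee_wpmul2l// lee_fin.
- by rewrite ge0_integralZl// EFinM lee_wpmul2l// lee_fin.
Qed.

Lemma uexp_sum (I : Type) (r : seq I) (Q : pred I) (h : I -> T -> R)
    (c : I -> R) : (forall i, Q i -> uexp (h i) (c i)) ->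
  uexp (fun x => \sum_(i <- r | Q i) h i x) (\sum_(i <- r | Q i) c i).
Proof.
move=> hc; elim: r => [|i r ih].
  by rewrite big_nil; apply: (uexp_le (uexp_cst (lexx 0))) => // x; rewrite big_nil.
rewrite big_cons; case: ifPn => Qi.
  by apply: (uexp_le (uexpD (hc i Qi) ih)) => // x; rewrite big_cons Qi.
by apply: (uexp_le ih) => // x; rewrite big_cons (negbTE Qi).
Qed.

(** The majorant is raised to [+oo] on the null set [N], which adds [+oo * 0 = 0] to its
    integral. *)
Lemma uexp_ae (N : set T) h' h c : measurable N -> P N = 0%E -> uexp h' c ->
  (forall x, ~ N x -> h x <= h' x) -> uexp h c.
Proof.
move=> mN N0 [g [m p l i]] hh.
exists (fun x => g x + +oo * (\1_N x)%:E)%E; split.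
- apply: emeasurable_funD => //; apply: measurable_funeM.
  exact/measurable_EFinP/measurable_indic.
- by move=> x; rewrite adde_ge0// mule_ge0// lee_fin.
- move=> x; rewrite indicE; have [xN|xN] := boolP (x \in N).
    rewrite mule1 addey ?leey//.
    by have := p x; case: (g x).
  rewrite mule0 adde0; apply: le_trans (l x); rewrite lee_fin hh//.
  by move=> Nx; move: xN; rewrite notin_setE; apply.
- have m1 : measurable_fun setT (EFin \o (\1_N : T -> R)).
    exact/measurable_EFinP/measurable_indic.
  have p1 x : setT x -> (0 <= (EFin \o (\1_N : T -> R)) x)%E.
    by move=> _; rewrite lee_fin.
  have p2 x : setT x -> (0 <= +oo * (\1_N x : R)%:E)%E.
    by move=> /p1 ?; exact: mule_ge0.
  rewrite (ge0_integralD _ _ _ _ p2)//; last exact: measurable_funeM.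
  rewrite (ge0_integralZl _ _ m1 p1)//.
  by rewrite integral_indic// setIT [X in (+oo * X)%E]N0 mule0 adde0.
Qed.

(** Monotone convergence for majorants. The number [L] of terms may depend on the outcome, so layer
    sums of random length are allowed. *)
Lemma uexp_series (h : nat -> T -> R) (c : nat -> R) h0 c0 :
  (forall i, uexp (h i) (c i)) ->
  (forall L, \sum_(i < L) c i <= c0) ->
  (forall x, exists L, h0 x <= \sum_(i < L) h i x) ->
  uexp h0 c0.
Proof.
move=> /choice[g gP] cc hL.
have m i : measurable_fun setT (g i) by case: (gP i).
have p i x : (0 <= g i x)%E by case: (gP i).
exists (fun x => \sum_(i <oo) g i x)%E; split.
- exact: ge0_emeasurable_sum.
- by move=> x; apply: nneseries_ge0 => *.
- move=> x; have [L /le_trans hx] := hL x.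
  apply: (@le_trans _ _ (\sum_(0 <= i < L) g i x)%E).
    rewrite big_mkord; apply: (@le_trans _ _ (\sum_(i < L) (h i x)%:E)%E).
      by rewrite sumEFin lee_fin; apply: hx.
    by apply: lee_sum => i _; case: (gP i).
  by apply: nneseries_lim_ge => *.
- rewrite integral_nneseries//.
  apply: lime_le; first by apply: is_cvg_nneseries => *; exact: integral_ge0.
  near=> L; apply: (@le_trans _ _ (\sum_(0 <= i < L) (c i)%:E)%E).
    by apply: lee_sum => i _; case: (gP i).
  by rewrite sumEFin lee_fin big_mkord.
Unshelve. all: by end_near. Qed.

End UpperExpectation.

(** * Shortest paths and opening costs *)

Section FiniteInf.
Context {R : realType}.

Lemma inf_mem_finite (X : set R) : finite_set X -> X !=set0 -> X (inf X).
Proof.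
move=> /finite_seqP[s Xs] X0.
have [x xs xmin] : exists2 x, x \in s & forall y, y \in s -> x <= y.
  have : s != [::].
    by apply/eqP => s0; case: X0 => x; rewrite Xs s0.
  elim: s {Xs} => // a s ih _.
  have [->|/ih[x xs xmin]] := eqVneq s [::].
    by exists a; rewrite ?mem_seq1// => y; rewrite mem_seq1 => /eqP ->.
  have [ax|xa] := leP a x.
    exists a; first by rewrite mem_head.
    move=> y; rewrite inE => /predU1P[->//|/xmin]; exact: le_trans.
  exists x; first by rewrite inE xs orbT.
  by move=> y; rewrite inE => /predU1P[->|/xmin//]; exact: ltW.
have lbx : lbound X x by move=> y; rewrite Xs => /xmin.
have Xx : X x by rewrite Xs.
suff -> : inf X = x by [].
apply/eqP; rewrite eq_le lb_le_inf// andbT.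
by apply: ge_inf => //; exists x.
Qed.

End FiniteInf.

Section ShortestPaths.
Context {R : realType} (n : nat).
Variable w : 'I_n -> 'I_n -> R.
Hypothesis w_gt0 : forall u v, u != v -> 0 < w u v.

Definition conn (U : {set 'I_n}) (v : 'I_n) : R :=
  inf [set sp_dist w u v | u in [set u | u \in U]].

Lemma walk_weight_ge0 x p : uniq (x :: p) -> 0 <= walk_weight w x p.
Proof.
elim: p x => //= y p ih x /andP[]; rewrite inE negb_or => /andP[xy _] yp.
by rewrite addr_ge0 ?ih// ltW ?w_gt0.
Qed.

Lemma walk_weight_rcons x p y :
  walk_weight w x (rcons p y) = walk_weight w x p + w (last x p) y.
Proof. by elim: p x => [|z p ih] x /=; rewrite ?addr0 ?add0r// ih addrA. Qed.

Let paths u v := [set x | exists p : seq 'I_n,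
  [/\ uniq (u :: p), last u p = v & x = walk_weight w u p]].

Let paths_finite u v : finite_set (paths u v).
Proof.
apply: (@sub_finite_set _ _
  ((fun b : n.-bseq 'I_n => walk_weight w u b) @` setT)).
  move=> _ [p [up _ ->]]; have sp : (size p <= n)%N.
    have := max_card [in u :: p]; rewrite card_ord (card_uniqP up) /=.
    exact: ltnW.
  by exists (Bseq sp).
by apply: finite_image; exact: finite_finset.
Qed.

Let paths_neq0 u v : paths u v !=set0.
Proof.
have [->|uv] := eqVneq u v; first by exists 0, [::].
by exists (walk_weight w u [:: v]), [:: v]; split=> //=; rewrite inE uv.
Qed.

Lemma sp_dist_attained u v : exists p : seq 'I_n,
  [/\ uniq (u :: p), last u p = v & sp_dist w u v = walk_weight w u p].
Proof. exact: (inf_mem_finite (@paths_finite u v) (@paths_neq0 u v)). Qed.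

Lemma sp_dist_le u p : uniq (u :: p) ->
  sp_dist w u (last u p) <= walk_weight w u p.
Proof.
move=> up; apply: ge_inf; last by exists p.
by exists 0 => _ [q [uq _ ->]]; exact: walk_weight_ge0.
Qed.

Lemma sp_dist_ge0 u v : 0 <= sp_dist w u v.
Proof. by have [p [up _ ->]] := sp_dist_attained u v; exact: walk_weight_ge0. Qed.

Lemma conn_attained (U : {set 'I_n}) v : (0 < #|U|)%N ->
  exists2 u, u \in U & conn U v = sp_dist w u v.
Proof.
move=> /card_gt0P[u0 u0U].
have [u uU <-] : [set sp_dist w u v | u in [set u | u \in U]] (conn U v).
  apply: inf_mem_finite; first by apply: finite_image; exact: finite_finset.
  by exists (sp_dist w u0 v), u0.
by exists u.
Qed.

Lemma conn_le (U : {set 'I_n}) u v : u \in U -> conn U v <= sp_dist w u v.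
Proof.
move=> uU; apply: ge_inf; last by exists u.
by exists 0 => _ [? _ <-]; exact: sp_dist_ge0.
Qed.

Lemma conn_ge0 (U : {set 'I_n}) v : (0 < #|U|)%N -> 0 <= conn U v.
Proof. by move=> /conn_attained -/(_ v)[u _ ->]; exact: sp_dist_ge0. Qed.

Lemma conn_in (U : {set 'I_n}) v : v \in U -> conn U v = 0.
Proof.
move=> vU; apply/eqP; rewrite eq_le conn_ge0 ?andbT; last by apply/card_gt0P; exists v.
by apply: le_trans (conn_le v vU) _; exact: (@sp_dist_le v [::]).
Qed.

Lemma conn_le_edge (U : {set 'I_n}) u v : u \in U -> v \notin U ->
  conn U v <= w u v.
Proof.
move=> uU vU; have uv : u != v by apply: contraNneq vU => <-.
apply: le_trans (conn_le v uU) _.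
by have /= := @sp_dist_le u [:: v]; rewrite inE uv addr0; apply.
Qed.

(* The last edge of a shortest path from [U] to [v]. *)
Lemma conn_parent (U : {set 'I_n}) v : (0 < #|U|)%N -> v \notin U ->
  exists2 y, y != v & conn U y + w y v <= conn U v.
Proof.
move=> U0 vU; have [u uU ->] := conn_attained v U0.
have uv : u != v by apply: contraNneq vU => <-.
have [p [+ + ->]] := sp_dist_attained u v.
case/lastP: p => [_ /= /eqP|p z]; first by rewrite (negbTE uv).
rewrite last_rcons => + zv; rewrite zv -rcons_cons rcons_uniq => /andP[vp up].
exists (last u p); first by apply: contraNneq vp => <-; exact: mem_last.
rewrite walk_weight_rcons lerD2r (le_trans (conn_le _ uU))//.
exact: sp_dist_le.
Qed.

End ShortestPaths.

Section EdgeWeights.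
Context {R : realType} (n : nat).
Variable W : 'I_n * 'I_n -> R.
Hypothesis W_gt0 : forall e : 'I_n * 'I_n, (e.1 < e.2)%N -> 0 < W e.
Let w := edge_w W.

Lemma edge_w_gt0 u v : u != v -> 0 < edge_w W u v.
Proof.
rewrite /edge_w; case: (ltngtP u v) => [uv _|vu _|/val_inj->].
- exact: W_gt0.
- exact: W_gt0.
- by rewrite eqxx.
Qed.

Definition short_edges (t : R) : {set 'I_n * 'I_n} :=
  [set e : 'I_n * 'I_n | (e.1 < e.2)%N && (W e < t)].

(* Distances to [U] strictly decrease along parent edges, so two vertices
   cannot be joined by a parent edge of both. *)
Lemma card_conn_lt (U : {set 'I_n}) t : (0 < #|U|)%N ->
  (#|[set v | (v \notin U) && (conn w U v < t)%R]%SET| <= #|short_edges t|)%N.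
Proof.
move=> U0; set Z := [set v | _]%SET.
(* [par v] is a predecessor of [v] on the way from [U]; by [conn_parent] the default [v] is never
   taken outside [U]. *)
pose par v := odflt v [pick y | (y != v) && (conn w U y + w y v <= conn w U v)].
have parP v : v \notin U ->
    par v != v /\ conn w U (par v) + w (par v) v <= conn w U v.
  move=> vU; rewrite /par; case: pickP => [y /andP[]//|].
  have [y yv yle] := conn_parent edge_w_gt0 U0 vU.
  by move=> /(_ y); rewrite yv yle.
(* The parent edge with its smaller endpoint first, as [edge_w] reads it. *)
pose ev v := if (par v < v)%N then (par v, v) else (v, par v).
have par_lt v : v \notin U -> conn w U (par v) < conn w U v.
  move=> /parP[pv]; apply: lt_le_trans.
  by rewrite ltrDl edge_w_gt0.
rewrite -(@card_in_imset _ _ ev Z); last first.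
  move=> u v; rewrite !inE => /andP[/par_lt pu _] /andP[/par_lt pv _].
  rewrite /ev; case: ifP => _; case: ifP => _ [] // a b.
  - by move: pu pv; rewrite a -b => /lt_trans H /H; rewrite ltxx.
  - by move: pu pv; rewrite b -a => /lt_trans H /H; rewrite ltxx.
apply/subset_leq_card/fintype.subsetP => _ /imsetP[v + ->].
rewrite !inE => /andP[vU vt]; have [pv ple] := parP v vU.
have wt : w (par v) v < t.
  apply: le_lt_trans vt; apply: le_trans ple.
  by rewrite lerDr conn_ge0//; exact: edge_w_gt0.
move: wt; rewrite /ev /w /edge_w; case: ifP => //= [->//|].
move: pv; rewrite -val_eqE /= => pv /negbT.
by rewrite -leqNgt leq_eqVlt eq_sym (negbTE pv) /= => -> ->.
Qed.

(** Vertices outside [U] with connection cost below [t] are at most as many as the edges shorter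
    than [t]; each remaining vertex outside [U] pays at least [t]. *)
Lemma sum_conn_ge (U : {set 'I_n}) (t : R) : 0 <= t -> (0 < #|U|)%N ->
  t * (n%:R - #|U|%:R - #|short_edges t|%:R) <= \sum_v conn w U v.
Proof.
move=> t0 U0.
pose Z : {set 'I_n} := [set v | (v \notin U) && (conn w U v < t)]%SET.
pose Y : {set 'I_n} := [set v | (v \notin U) && (t <= conn w U v)]%SET.
have cZY : (#|Z| + #|Y| = n - #|U|)%N.
  have -> : (n - #|U| = #|~: U|)%N by rewrite [RHS]cardsCs finset.setCK card_ord.
  rewrite -(cardsID Z (~: U)); congr (_ + _)%N; apply: eq_card => v; rewrite !inE.
    by case: (v \in U).
  by case: (v \in U) => //=; rewrite leNgt andbT.
have Un : (#|U| <= n)%N by rewrite -[X in (_ <= X)%N]card_ord max_card.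
rewrite (bigID (fun v => v \in Y)) /=.
apply: (@le_trans _ _ (\sum_(v in Y) t)).
  rewrite sumr_const -[leRHS]mulr_natr ler_wpM2l// -natrB// -cZY natrD.
  by rewrite addrAC gerDr subr_le0 ler_nat card_conn_lt.
apply: (@le_trans _ _ (\sum_(v in Y) conn w U v)).
  by apply: ler_sum => v; rewrite inE => /andP[].
rewrite lerDl sumr_ge0// => v _; exact: conn_ge0 edge_w_gt0 _ _ U0.
Qed.

End EdgeWeights.

Lemma card_first_set n k : (k <= n)%N -> #|first_set n k| = k.
Proof.
move=> kn; have inj : injective (widen_ord kn) by move=> i j [] /val_inj.
rewrite -[RHS](card_ord k) -(card_imset _ inj).
apply: eq_card => i; rewrite inE; apply/idP/imsetP => [ik|[j _ ->]//=].
by exists (Ordinal ik) => //; exact: val_inj.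
Qed.

Section OpeningCosts.
Context {R : realType} (n : nat).
Variable f : 'I_n -> R.
Hypothesis f_gt0 : forall i, 0 < f i.
Hypothesis f_sorted : forall i j : 'I_n, (i <= j)%N -> f i <= f j.

Lemma Fsum_first_set k : Fsum f k = \sum_(i in first_set n k) f i.
Proof. by apply: eq_bigl => i; rewrite inE. Qed.

Lemma Fsum_ge0 k : 0 <= Fsum f k.
Proof. by apply: sumr_ge0 => i _; exact: ltW. Qed.

Lemma Fsum_le k l : (k <= l)%N -> Fsum f k <= Fsum f l.
Proof.
move=> kl; rewrite /Fsum [leRHS](bigID (fun i : 'I_n => (i < k)%N)) /=.
rewrite [X in X + _](eq_bigl (fun i : 'I_n => (i < k)%N)); last first.
  move=> i /=; lia.
by rewrite lerDl sumr_ge0// => i _; exact: ltW.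
Qed.

(** Exchange argument: [V :\: U] and [U :\: V] have the same size, and the cost at index [m.-1]
    separates the costs in the two sets. *)
Lemma Fsum_le_sum (U : {set 'I_n}) : Fsum f #|U| <= \sum_(i in U) f i.
Proof.
set m := #|U|; have mn : (m <= n)%N by rewrite -[X in (_ <= X)%N]card_ord max_card.
have [m0|m0] := posnP m.
  by rewrite /Fsum big_pred0 ?sumr_ge0// => [i _|i]; [exact: ltW|rewrite m0].
have mp : (m.-1 < n)%N by rewrite prednK.
pose V := first_set n m; have cV : #|V| = m by exact: card_first_set.
rewrite Fsum_first_set -/V.
rewrite (big_setID U) [leRHS](big_setID V) /= finset.setIC lerD2l.
have cD : #|V :\: U| = #|U :\: V|.
  by apply/eqP; rewrite -(eqn_add2l #|V :&: U|) cardsID cV finset.setIC cardsID.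
apply: (@le_trans _ _ (\sum_(i in V :\: U) f (Ordinal mp))).
  apply: ler_sum => i; rewrite !inE => /andP[_ im]; apply: f_sorted => /=; lia.
rewrite sumr_const cD -sumr_const.
apply: ler_sum => i; rewrite !inE -leqNgt => /andP[im _]; apply: f_sorted => /=; lia.
Qed.

Lemma Fsum_gt0 k : (0 < n)%N -> (0 < k)%N -> 0 < Fsum f k.
Proof.
move=> n0 k0; rewrite /Fsum (bigD1 (Ordinal n0))//=.
by rewrite ltr_wpDr// sumr_ge0// => i _; exact: ltW.
Qed.

End OpeningCosts.

(** * Exponential edge weights *)

Section ExponentialWeights.
Context (d : measure_display) (T : measurableType d) (R : realType).
Variables (P : probability T R) (n : nat) (W : 'I_n * 'I_n -> {RV P >-> R}).
Hypothesis HW : rsp_model W.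
Implicit Types (e : 'I_n * 'I_n) (J : {set 'I_n * 'I_n}) (B : set R).

Let wom om := fun e => W e om.

Lemma measurable_edge e B : measurable B -> measurable (W e @^-1` B).
Proof. by move=> mB; rewrite -[X in measurable X]setTI; exact: measurable_funP. Qed.

Lemma edge_cdf e (t : R) : (e.1 < e.2)%N -> 0 < t ->
  P (W e @^-1` `[0, t]) = (1 - expR (- t))%:E.
Proof.
move=> he t0; have := HW.1 e he `[0, t]%classic (measurable_itv _).
by rewrite exponential_prob_itv0c// mulN1r.
Qed.

Lemma edge_tail e (t : R) : (e.1 < e.2)%N -> 0 <= t ->
  (P (W e @^-1` (~` `[0%R, t])) <= (expR (- t))%:E)%E.
Proof.
move=> he; rewrite le_eqVlt => /predU1P[<-|t0].
  rewrite oppr0 expR0; apply: probability_le1; apply: measurable_edge.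
  by apply: measurableC; exact: measurable_itv.
rewrite preimage_setC probability_setC; last exact: measurable_edge (measurable_itv _).
by rewrite edge_cdf// -EFinB lee_fin; lra.
Qed.

(** On [[0, s]] the mass is [1 - exp(-s) <= s]. Negative values lie outside [[0, 1/eps]], an event
    of probability at most [exp(-1/eps) <= eps]. *)
Lemma edge_lt e (s : R) : (e.1 < e.2)%N -> 0 < s ->
  (P (W e @^-1` `]-oo, s[) <= s%:E)%E.
Proof.
move=> he s0; apply/lee_addgt0Pr => eps eps0.
have t0 : 0 < eps^-1 by rewrite invr_gt0.
have sub : W e @^-1` `]-oo, s[ `<=`
    W e @^-1` `[0, s] `|` W e @^-1` (~` `[0, eps^-1]).
  move=> x /=; rewrite !in_itv /= => xs.
  have [W0|W0] := leP 0 (W e x); first by left; rewrite ltW.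
  by right.
have m1 := measurable_edge e (measurable_itv `[0, s]).
have m2 := measurable_edge e (measurableC (measurable_itv `[0, eps^-1])).
apply: (le_trans (le_measure _ _ _ sub)).
- by rewrite inE; exact: measurable_edge (measurable_itv _).
- by rewrite inE; exact: measurableU.
apply: (le_trans (measureU2 _ _ _)) => //; apply: leeD.
  rewrite [leLHS](edge_cdf he s0) lee_fin.
  by have := expR_ge1Dx (- s); lra.
apply: (le_trans (edge_tail he (ltW t0))).
rewrite lee_fin expRN -[leRHS]invrK lef_pV2 ?posrE ?expR_gt0//.
by have := expR_ge1Dx eps^-1; lra.
Qed.

(** The exceptional null event: off it every edge weight is positive, as the deterministic graph
    lemmas require. *)
Definition nonpos_edge : set T :=
  \bigcup_(e in [set e : 'I_n * 'I_n | (e.1 < e.2)%N]) (W e @^-1` `]-oo, 0]).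

Lemma measurable_nonpos_edge : measurable nonpos_edge.
Proof.
apply: fin_bigcup_measurable => [|e _]; first exact: finite_finset.
by apply: measurable_edge; exact: measurable_itv.
Qed.

Lemma nonpos_edge_null : P nonpos_edge = 0%E.
Proof.
have null e : (e.1 < e.2)%N -> P.-negligible (W e @^-1` `]-oo, 0]).
  move=> he; have m0 := measurable_edge e (measurable_itv `]-oo, 0]).
  apply/negligibleP => //; apply/eqP; rewrite eq_le measure_ge0 andbT.
  apply/lee_addgt0Pr => s s0; rewrite add0e; apply: le_trans (edge_lt he s0).
  apply: le_measure; rewrite ?inE//; first exact: measurable_edge (measurable_itv _).
  by move=> x /=; rewrite !in_itv /= => /le_lt_trans; apply.
apply/negligibleP; first exact: measurable_nonpos_edge.
pose F k := if (unpickle k : option ('I_n * 'I_n)) is Some e then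
  if (e.1 < e.2)%N then W e @^-1` `]-oo, 0] else set0 else set0.
apply: (@negligibleS _ _ _ _ (\bigcup_k F k)).
  move=> x [e /= he xe]; exists (pickle e) => //.
  by rewrite /F pickleK he.
apply: negligible_bigcup => k; rewrite /F.
case: unpickle => [e|]; last exact: negligible_set0.
by case: ifP => [/null//|_]; exact: negligible_set0.
Qed.

Lemma edge_gt0 om : ~ nonpos_edge om -> forall e, (e.1 < e.2)%N -> 0 < wom om e.
Proof.
move=> h e he; rewrite ltNge; apply/negP => We; apply: h; by exists e.
Qed.

Lemma edges_joint J B p : 0 <= p -> measurable B ->
  (forall e, e \in J -> (e.1 < e.2)%N) ->
  (forall e, e \in J -> (P (W e @^-1` B) <= p%:E)%E) ->
  (P (\bigcap_(e in [set e | e \in J]) (W e @^-1` B)) <= (p ^+ #|J|)%:E)%E.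
Proof.
move=> p0 mB hJ hp; rewrite (HW.2 J (fun=> B))//.
suff /andP[] : (0 <= \prod_(e in J) P (W e @^-1` B) <= \prod_(e in J) p%:E)%E.
  by move=> _ /le_trans; apply; rewrite prodEFin prodr_const.
elim/big_ind2 : _ => //.
- by rewrite lexx lee01.
- move=> x1 x2 y1 y2 /andP[? ?] /andP[? ?].
  by rewrite mule_ge0//= lee_pmul.
- by move=> e eJ; rewrite measure_ge0 /= hp.
Qed.

Lemma measurable_edges J B : measurable B ->
  measurable (\bigcap_(e in [set e | e \in J]) (W e @^-1` B)).
Proof.
move=> mB; apply: fin_bigcap_measurable => [|e _]; first exact: finite_finset.
exact: measurable_edge.
Qed.

(** The binomial counts the [k]-sets of edges that are all short. There are at most ['C(n ^ 2, k)]
    candidate sets, and by independence each is short with probability at most [t ^+ k]. *)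
Lemma uexp_bin_short_edges k (t : R) : 0 < t ->
  uexp P (fun om => 'C(#|short_edges (wom om) t|, k)%:R)
    ('C(n ^ 2, k)%:R * t ^+ k).
Proof.
move=> t0.
pose E : {set 'I_n * 'I_n} := [set e : 'I_n * 'I_n | (e.1 < e.2)%N]%SET.
pose D := [set A : {set 'I_n * 'I_n} | (A \subset E) && (#|A| == k)]%SET.
pose H (J : {set 'I_n * 'I_n}) :=
  \bigcap_(e in [set e | e \in J]) (W e @^-1` `]-oo, t[).
have hD A : A \in D -> uexp P (\1_(H A)) (t ^+ k).
  rewrite inE => /andP[/fintype.subsetP AE /eqP <-].
  have AE' e : e \in A -> (e.1 < e.2)%N by move=> /AE; rewrite inE.
  apply: uexp_indic; first by apply: measurable_edges; exact: measurable_itv.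
  apply: edges_joint => //; first exact: ltW.
  by move=> e /AE' he; exact: edge_lt.
apply: (uexp_le (uexp_sum (enum D) (fun A (AD : A \in D) => hD A AD))).
- move=> om; rewrite -cards_draws -sum1_card natr_sum [leRHS]big_enum_cond /=.
  rewrite [leRHS](eq_bigl (mem D)); last by move=> A; rewrite andbb.
  rewrite [leRHS](bigID (fun A : {set 'I_n * 'I_n} =>
      A \subset short_edges (wom om) t)) /= -[leLHS]addr0.
  apply: lerD; last by apply: sumr_ge0 => A _.
  rewrite le_eqVlt; apply/orP; left; apply/eqP.
  apply: eq_big => A.
    rewrite !inE; case: (boolP (A \subset short_edges _ _)) => [/fintype.subsetP As|]; last first.
      by rewrite andbF.
    rewrite /= andbT (_ : A \subset E)//.
    by apply/fintype.subsetP => e /As; rewrite !inE => /andP[].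
  rewrite inE => /andP[/fintype.subsetP As _].
  rewrite indicE mem_set// => e /= /As; rewrite inE => /andP[_ /=].
  by rewrite in_itv.
- rewrite big_enum_cond /= (eq_bigl (mem D)); last by move=> A; rewrite andbb.
  rewrite sumr_const -[leLHS]mulr_natl ler_wpM2r ?exprn_ge0 ?(ltW t0)// ler_nat.
  rewrite cards_draws; apply: leq_bin2l.
  by rewrite (leq_trans (max_card _))// card_prod card_ord mulnn.
Qed.

End ExponentialWeights.

(** * Lower bounds on the optimum *)

Section OptLowerBound.
Context {R : realType} (n : nat).
Variable f : 'I_n -> R.
Hypothesis f_gt0 : forall i, 0 < f i.
Hypothesis f_sorted : forall i j : 'I_n, (i <= j)%N -> f i <= f j.
Hypothesis n_gt0 : (0 < n)%N.
Variable W : 'I_n * 'I_n -> R.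
Hypothesis W_gt0 : forall e : 'I_n * 'I_n, (e.1 < e.2)%N -> 0 < W e.

Let w := edge_w W.

Let costs_neq0 :
  [set fl_cost f w U | U in [set U : {set 'I_n} | (0 < #|U|)%N]] !=set0.
Proof.
exists (fl_cost f w [set: 'I_n]%SET), [set: 'I_n]%SET => //=.
by rewrite cardsT card_ord.
Qed.

Lemma fl_cost_ge (U : {set 'I_n}) : (0 < #|U|)%N ->
  Fsum f #|U| + \sum_v conn w U v <= fl_cost f w U.
Proof. by move=> U0; rewrite lerD2r Fsum_le_sum. Qed.

Lemma fl_opt_ge : Fsum f 1 <= fl_opt f w.
Proof.
apply: lb_le_inf => // _ [U U0 <-]; apply: le_trans (fl_cost_ge U0).
rewrite -[leLHS]addr0 lerD ?Fsum_le// sumr_ge0// => v _.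
exact: conn_ge0 (edge_w_gt0 W_gt0) _ _ U0.
Qed.

Lemma fl_opt_gt0 : 0 < fl_opt f w.
Proof. exact: lt_le_trans (Fsum_gt0 f_gt0 _ _) fl_opt_ge. Qed.

(* If [k] facilities stay closed at cost below [s], then [F_(n-k) < s], and
   few short edges would force a large connection cost. *)
Lemma fl_opt_lt_short (s tau : R) (K : nat) : 0 < s -> s <= tau -> (3 <= K)%N ->
  (forall k, (k < K)%N -> k != 1%N -> k != 2%N -> tau <= Fsum f (n - k)) ->
  (fl_opt f w < s)%R%:R <=
    ((Fsum f (n - 1) < s)%R%:R + (Fsum f (n - 2) < s)%R%:R)
      * 'C(#|short_edges W s|, 1)%:R
    + 'C(#|short_edges W (s / K./2%:R)|, 3)%:R / 'C(K - K./2 + 1, 3)%:R :> R.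
Proof.
move=> s0 st K3 HK; have [/inf_lt opt_s|] := ltP (fl_opt f w) s; last first.
  by move=> _; rewrite addr_ge0 ?mulr_ge0 ?addr_ge0 ?invr_ge0 ?ler0n.
have [//|_ [U /= U0 <-] cU] := opt_s.
have Un : (#|U| <= n)%N by rewrite -[X in (_ <= X)%N]card_ord max_card.
have {}cU := le_lt_trans (fl_cost_ge U0) cU.
have conn0 : 0 <= \sum_v conn w U v.
  by apply: sumr_ge0 => v _; exact: conn_ge0 (edge_w_gt0 W_gt0) _ _ U0.
have FU0 := Fsum_gt0 f_gt0 n_gt0 U0.
have FU : Fsum f #|U| < s by lra.
have CU : \sum_v conn w U v < s by lra.
pose k := (n - #|U|)%N.
have nk : #|U| = (n - k)%N by rewrite /k; lia.
have kR : n%:R - #|U|%:R = k%:R :> R by rewrite -natrB.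
(* For [k < K] the bound [F_(n-k) < s <= tau] leaves only [k = 1, 2]. If no edge were shorter than
   [s], each closed vertex would pay at least [s]. *)
have [kK|Kk] := ltnP k K.
- have k12 : (k == 1%N) || (k == 2%N).
    apply/norP => -[k1 k2]; have := HK k kK k1 k2; rewrite -nk; lra.
  have N1 : (1 <= #|short_edges W s|)%N.
    rewrite lt0n; apply/eqP => N0.
    have := sum_conn_ge W_gt0 (ltW s0) U0; rewrite kR N0 subr0.
    apply/negP; rewrite -ltNge; apply: lt_le_trans CU _.
    rewrite -[leLHS]mulr1 ler_wpM2l ?(ltW s0)// ler1n.
    by case/orP: k12 => /eqP ->.
  rewrite bin1 -[leLHS]addr0 lerD ?divr_ge0//.
  rewrite -[leLHS]mulr1; apply: ler_pM => //; last by rewrite ler1n.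
  by case/orP: k12 => /eqP k12; rewrite k12 in nk; rewrite -nk FU ?lerDl ?lerDr.
(* With threshold [s / K./2], at most [K - K./2] short edges would leave at least [K./2] closed
   vertices paying the threshold, hence a connection cost of at least [s]. *)
- have h0 : 0 < (K./2)%:R :> R by rewrite ltr0n; lia.
  have t0 : 0 <= s / (K./2)%:R by rewrite divr_ge0 ?(ltW s0).
  have NK : (K - K./2 + 1 <= #|short_edges W (s / (K./2)%:R)|)%N.
    rewrite addn1 ltnNge; apply/negP => NK.
    have := sum_conn_ge W_gt0 t0 U0; rewrite kR.
    apply/negP; rewrite -ltNge; apply: lt_le_trans CU _.
    rewrite -mulrA ler_peMr ?(ltW s0)// mulrC ler_pdivlMr// mul1r.
    rewrite lerBrDr -natrD ler_nat; lia.
  have C0 : 0 < 'C(K - K./2 + 1, 3)%:R :> R by rewrite ltr0n bin_gt0; lia.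
  rewrite -[leLHS]add0r lerD ?mulr_ge0 ?addr_ge0 ?ler0n//.
  by rewrite ler_pdivlMr// mul1r ler_nat leq_bin2l.
Qed.

End OptLowerBound.

(** * Dyadic layers of the inverse square of the optimum *)

Section DyadicLayers.
Context {R : realType}.

(** For [K >= 3] one has [K./2 >= K / 3], and each factor of the falling factorial of [K - K./2 + 1]
    is at least [K / 6]; hence [18 = 3 * 6]. *)
Lemma bin3_ratio_le (n K : nat) (s : R) : 0 < s -> (3 <= K)%N ->
  'C(n ^ 2, 3)%:R * (s / K./2%:R) ^+ 3 / 'C(K - K./2 + 1, 3)%:R
    <= 18 ^+ 3 * (n%:R ^+ 2 / K%:R ^+ 2) ^+ 3 * s ^+ 3.
Proof.
move=> s0 K3; have K0 : 0 < K%:R :> R by rewrite ltr0n; lia.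
have b3 m : ('C(m, 3) * 6 = m * (m.-1 * m.-2))%N.
  by rewrite (bin_ffact m 3) !ffactnS ffactn0 muln1.
have hn : 'C(n ^ 2, 3)%:R <= (n%:R ^+ 2) ^+ 3 / 6 :> R.
  rewrite ler_pdivlMr// -natrX -natrX -natrM ler_nat b3.
  move: (n ^ 2)%N => m; rewrite !expnS expn0 muln1.
  by apply: leq_mul => //; apply: leq_mul; lia.
have hK : (K%:R / 6) ^+ 3 / 6 <= 'C(K - K./2 + 1, 3)%:R :> R.
  rewrite ler_pdivrMr// -natrM b3 !natrM !exprS expr0 mulr1.
  have K60 : 0 <= K%:R / 6 :> R by rewrite divr_ge0.
  have hK6 m : (K <= m * 6)%N -> K%:R / 6 <= m%:R :> R.
    by move=> Km; rewrite ler_pdivrMr// -natrM ler_nat.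
  apply: ler_pM => //; first by apply: hK6; lia.
  by apply: ler_pM => //; apply: hK6; lia.
have hh : (s / K./2%:R) ^+ 3 <= (s * 3 / K%:R) ^+ 3.
  rewrite lerXn2r ?nnegrE ?divr_ge0 ?mulr_ge0 ?(ltW s0)//.
  rewrite -mulrA ler_wpM2l ?(ltW s0)// -[X in _ <= X]invf_div lef_pV2 ?posrE.
  - by rewrite ler_pdivrMr// -natrM ler_nat; lia.
  - by rewrite ltr0n; lia.
  - by rewrite divr_gt0.
have C0 : 0 < (K%:R / 6) ^+ 3 / 6 :> R by rewrite divr_gt0// exprn_gt0// divr_gt0.
have -> : 18 ^+ 3 * (n%:R ^+ 2 / K%:R ^+ 2) ^+ 3 * s ^+ 3
    = (n%:R ^+ 2) ^+ 3 / 6 * (s * 3 / K%:R) ^+ 3 * ((K%:R / 6) ^+ 3 / 6)^-1 :> R.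
  by field; rewrite gt_eqF.
apply: ler_pM => //.
- by rewrite mulr_ge0// exprn_ge0// divr_ge0// ltW.
- by apply: ler_pM => //; rewrite exprn_ge0// divr_ge0// ltW.
- by rewrite lef_pV2// posrE (lt_le_trans C0).
Qed.

(** If [x < tau], the last [i] with [x < tau / 2 ^+ i] satisfies [x >= tau / 2 ^+ i.+1], so its
    summand alone dominates [(x ^+ 2)^-1]. *)
Lemma dyadic_inv_sqr (x tau : R) L : 0 < x -> 0 < tau -> tau / 2 ^+ L <= x ->
  tau <= x \/
  (x ^+ 2)^-1 <= \sum_(i < L) 4 ^+ i.+1 / tau ^+ 2 * (x < tau / 2 ^+ i)%R%:R.
Proof.
move=> x0 t0; elim: L => [|L ih].
  by rewrite expr0 divr1; left.
move=> hx; have [/ih[|h]|xL] := leP (tau / 2 ^+ L) x; first by left.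
  right; rewrite big_ord_recr /=; apply: le_trans h _.
  by rewrite lerDl mulr_ge0// divr_ge0// exprn_ge0// ltW.
right; rewrite big_ord_recr /= xL mulr1.
apply: (@le_trans _ _ (4 ^+ L.+1 / tau ^+ 2)); last first.
  by rewrite lerDr sumr_ge0// => i _; rewrite mulr_ge0// divr_ge0// exprn_ge0// ltW.
have -> : 4 = 2 ^+ 2 :> R by rewrite expr2; lra.
rewrite exprAC -expr_div_n -exprVn; apply: lerXn2r.
- by rewrite nnegrE invr_ge0 ltW.
- by rewrite nnegrE divr_ge0 ?exprn_ge0// ltW.
rewrite -[X in _ <= X]invf_div lef_pV2 ?posrE//.
by rewrite divr_gt0// exprn_gt0.
Qed.

(** The surviving terms form a geometric sum whose largest term is below [x]; none survives when
    [x <= 1]. *)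
Lemma sum_pow2_lt (x : R) L : 0 <= x ->
  \sum_(i < L) 2 ^+ i * (2 ^+ i < x)%R%:R <= 2 * x * (1 < x)%R%:R.
Proof.
move=> x0; have [x1|x1] := ltP 1 x; last first.
  rewrite mulr0 big1// => i _; rewrite ltNge (le_trans x1) ?mulr0//.
  by rewrite exprn_ege1// ler1n.
rewrite mulr1; elim: L => [|L ih]; first by rewrite big_ord0 mulr_ge0.
have [xL|xL] := ltP (2 ^+ L) x; last first.
  by rewrite big_ord_recr /= ltNge xL mulr0 addr0.
apply: (@le_trans _ _ (\sum_(i < L.+1) 2 ^+ i)).
  by apply: ler_sum => i _; rewrite ler_piMr ?exprn_ge0// lern1 leq_b1.
have -> : \sum_(i < L.+1) 2 ^+ i = 2 ^+ L.+1 - 1 :> R.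
  by rewrite [RHS]subrX1 (_ : 2 - 1 = 1) ?mul1r//; lra.
rewrite exprS; lra.
Qed.

Lemma sum_half_le L : \sum_(i < L) (2 ^+ i)^-1 <= 2 :> R.
Proof.
suff : \sum_(i < L) (2 ^+ i)^-1 = 2 - 2 * (2 ^+ L)^-1 :> R.
  by move=> ->; rewrite gerBl mulr_ge0// invr_ge0 exprn_ge0.
elim: L => [|L ih]; first by rewrite big_ord0 expr0; lra.
by rewrite big_ord_recr /= ih exprS invfM; lra.
Qed.

End DyadicLayers.

Section OptMoments.
Context (d : measure_display) (T : measurableType d) (R : realType).
Variables (P : probability T R) (n : nat) (W : 'I_n * 'I_n -> {RV P >-> R}).
Hypothesis HW : rsp_model W.
Variable f : 'I_n -> R.
Hypothesis f_gt0 : forall i, 0 < f i.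
Hypothesis f_sorted : forall i j : 'I_n, (i <= j)%N -> f i <= f j.
Hypothesis n_ge3 : (3 <= n)%N.
Variables (tau : R) (K : nat).
Hypothesis tau_gt0 : 0 < tau.
Hypothesis K_ge3 : (3 <= K)%N.
Hypothesis tau_le : forall k, (k < K)%N -> k != 1%N -> k != 2%N ->
  tau <= Fsum f (n - k).

Let n_gt0 : (0 < n)%N. Proof. by lia. Qed.
Let opt om := fl_opt f (edge_w (fun e => W e om)).
Let F k := Fsum f (n - k).
Let N2 : R := n%:R ^+ 2.
Let Q : R := (n%:R ^+ 2 / K%:R ^+ 2) ^+ 3.

Let F_gt0 k : (k < n)%N -> 0 < F k.
Proof. by move=> kn; apply: Fsum_gt0 => //; lia. Qed.

(** Expectation of [fl_opt_lt_short] through the first and third factorial moments. The cubic term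
    beats the layer weights [4 ^+ i]; the linear one does not, and relies on the cutoffs [F 1 < s]
    and [F 2 < s]. *)
Lemma uexp_opt_lt (s : R) : 0 < s -> s <= tau ->
  uexp P (fun om => (opt om < s)%R%:R)
    (((F 1 < s)%R%:R + (F 2 < s)%R%:R) * (N2 * s) + 18 ^+ 3 * Q * s ^+ 3).
Proof.
move=> s0 st.
have h0 : 0 < K./2%:R :> R by rewrite ltr0n; lia.
have t0 : 0 < s / K./2%:R by rewrite divr_gt0.
pose a : R := (F 1 < s)%R%:R + (F 2 < s)%R%:R.
have a0 : 0 <= a by rewrite addr_ge0.
pose b : R := 'C(K - K./2 + 1, 3)%:R.
have b0 : 0 <= b^-1 by rewrite invr_ge0.
have U1 := uexpZ a0 (uexp_bin_short_edges HW 1 s0).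
have U3 := uexpZ b0 (uexp_bin_short_edges HW 3 t0).
have U := uexp_le (uexpD U1 U3) (fun=> lexx _) _.
apply: (uexp_ae (measurable_nonpos_edge W) (nonpos_edge_null HW) (U _ _)).
- rewrite bin1 expr1 natrX lerD2l mulrC; exact: bin3_ratio_le.
- move=> om /edge_gt0 om_gt0; rewrite [b^-1 * _]mulrC.
  exact: (fl_opt_lt_short f_gt0 f_sorted n_gt0 om_gt0 s0 st K_ge3 tau_le).
Qed.

(* Bounds [E[OPT^-2; OPT < tau]]. *)
Definition opt_moment : R :=
  8 * N2 / F 1 * (F 1 < tau)%R%:R + 8 * N2 / F 2 * (F 2 < tau)%R%:R
  + 8 * 18 ^+ 3 * Q * tau.

Let layers L om :=
  \sum_(i < L) 4 ^+ i.+1 / tau ^+ 2 * (opt om < tau / 2 ^+ i)%R%:R.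

(** Layer weight times probability grows like [2 ^+ i], and the indicator stops the sum at
    [2 ^+ i < tau / F k]. *)
Let sum_floor L k : (k < n)%N ->
  \sum_(i < L) 4 ^+ i.+1 / tau ^+ 2
      * ((F k < tau / 2 ^+ i)%R%:R * (N2 * (tau / 2 ^+ i)))
    <= 8 * N2 / F k * (F k < tau)%R%:R.
Proof.
move=> kn; have Fk := F_gt0 kn.
have N20 : 0 <= N2 by rewrite exprn_ge0.
have -> : 8 * N2 / F k * (F k < tau)%R%:R =
    4 * N2 / tau * (2 * (tau / F k) * (1 < tau / F k)%R%:R).
  rewrite ltr_pdivlMr// mul1r; field.
  by rewrite !gt_eqF.
apply: le_trans (ler_wpM2l _ (sum_pow2_lt L _)); last 2 first.
- by rewrite divr_ge0 ?mulr_ge0// ltW.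
- by rewrite divr_ge0// ltW.
rewrite mulr_sumr; apply: ler_sum => i _.
have i0 : 0 < 2 ^+ i :> R by rewrite exprn_gt0.
rewrite !ltr_pdivlMr// [X in (X < _)%R]mulrC.
have -> : 4 ^+ i.+1 = 4 * (2 ^+ i * 2 ^+ i) :> R.
  by rewrite -exprMn exprS; congr (_ * _ ^+ _); lra.
rewrite le_eqVlt; apply/orP; left; apply/eqP; field.
by rewrite !gt_eqF.
Qed.

Let uexp_layers L : uexp P (layers L) opt_moment.
Proof.
have Qt0 : 0 <= Q * tau.
  by rewrite mulr_ge0 ?(ltW tau_gt0)// exprn_ge0// divr_ge0// exprn_ge0.
apply: (uexp_le (uexp_sum (index_enum 'I_L) (Q := xpredT)
  (h := fun i om => 4 ^+ (i : nat).+1 / tau ^+ 2 * (opt om < tau / 2 ^+ i)%R%:R)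
  (c := fun i : 'I_L => 4 ^+ i.+1 / tau ^+ 2 *
    (((F 1 < tau / 2 ^+ i)%R%:R + (F 2 < tau / 2 ^+ i)%R%:R) * (N2 * (tau / 2 ^+ i))
       + 18 ^+ 3 * Q * (tau / 2 ^+ i) ^+ 3)) _)) => //.
- move=> i _; apply: uexpZ; first by rewrite divr_ge0 ?exprn_ge0 ?(ltW tau_gt0).
  have i1 : 1 <= 2 ^+ i :> R by rewrite exprn_ege1// ler1n.
  apply: uexp_opt_lt; first by rewrite divr_gt0// exprn_gt0.
  by rewrite ler_pdivrMr ?exprn_gt0// ler_peMr// ltW.
- rewrite (eq_bigr (fun i : 'I_L =>
      4 ^+ i.+1 / tau ^+ 2 * ((F 1 < tau / 2 ^+ i)%R%:R * (N2 * (tau / 2 ^+ i)))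
      + 4 ^+ i.+1 / tau ^+ 2 * ((F 2 < tau / 2 ^+ i)%R%:R * (N2 * (tau / 2 ^+ i)))
      + 4 * 18 ^+ 3 * (Q * tau) * (2 ^+ i)^-1)); last first.
    move=> i _; have i0 : 0 < 2 ^+ i :> R by rewrite exprn_gt0.
    have -> : 4 ^+ i.+1 = 4 * (2 ^+ i * 2 ^+ i) :> R.
      by rewrite -exprMn exprS; congr (_ * _ ^+ _); lra.
    field.
    by rewrite !gt_eqF.
  have [n1 n2] : (1 < n)%N /\ (2 < n)%N by lia.
  rewrite 2!big_split /= /opt_moment; apply: lerD.
    by apply: lerD; exact: sum_floor.
  rewrite -mulr_sumr; have -> : 8 * 18 ^+ 3 * Q * tau = 4 * 18 ^+ 3 * (Q * tau) * 2 by ring.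
  by rewrite ler_wpM2l ?sum_half_le// mulr_ge0.
Qed.

(** Off the null event [OPT >= F_1], a deterministic floor, so a single depth [L] serves all
    outcomes. *)
Let exists_layer : exists L, forall om, ~ nonpos_edge W om ->
  0 < opt om /\ tau / 2 ^+ L <= opt om.
Proof.
have F1 : 0 < Fsum f 1 by exact: Fsum_gt0.
have [L tL] : exists L, tau / 2 ^+ L <= Fsum f 1.
  exists (Num.truncn (tau / Fsum f 1)).+1.
  rewrite ler_pdivrMr ?exprn_gt0// -ler_pdivrMl// mulrC.
  apply: ltW; apply: lt_le_trans (truncnS_gt _) _.
  by rewrite -natrX ler_nat ltnW// ltn_expl.
exists L => om /edge_gt0 om_gt0.
split; first exact: fl_opt_gt0.
by apply: le_trans tL _; exact: fl_opt_ge.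
Qed.

(** AM-GM is applied only where [OPT < tau], so that [tau^-1] keeps the constant 1; [mu] is left
    free to balance the rest. *)
Lemma uexp_opt_inv (mu : R) : 0 < mu ->
  uexp P (fun om => (opt om)^-1) (tau^-1 + (mu + opt_moment / mu) / 2).
Proof.
move=> mu0; have [L HL] := exists_layer.
have V0 : 0 <= tau^-1 + mu / 2.
  by rewrite addr_ge0 ?invr_ge0 ?divr_ge0 ?(ltW tau_gt0) ?(ltW mu0).
have m0 : 0 <= mu^-1 / 2 by rewrite divr_ge0 ?invr_ge0 ?(ltW mu0).
have U := uexp_le (uexpD (uexp_cst P V0) (uexpZ m0 (uexp_layers L))) (fun=> lexx _) _.
apply: (uexp_ae (measurable_nonpos_edge W) (nonpos_edge_null HW) (U _ _)).
  rewrite le_eqVlt; apply/orP; left; apply/eqP; field.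
  by rewrite !gt_eqF.
move=> om /HL[ o0 oL].
have lay0 : 0 <= layers L om.
  by apply: sumr_ge0 => i _; rewrite mulr_ge0// divr_ge0// exprn_ge0// ltW.
have [to|olay] := dyadic_inv_sqr o0 tau_gt0 oL.
  have : (opt om)^-1 <= tau^-1 by rewrite lef_pV2.
  have : 0 <= mu^-1 / 2 * layers L om by rewrite mulr_ge0.
  by lra.
have amgm : (opt om)^-1 <= mu / 2 + mu^-1 / 2 * (opt om ^+ 2)^-1.
  rewrite -subr_ge0.
  have -> : mu / 2 + mu^-1 / 2 * (opt om ^+ 2)^-1 - (opt om)^-1
      = (mu - (opt om)^-1) ^+ 2 / (2 * mu).
    by field; rewrite !gt_eqF.
  by rewrite divr_ge0 ?sqr_ge0// mulr_ge0// ltW.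
have : mu^-1 / 2 * (opt om ^+ 2)^-1 <= mu^-1 / 2 * layers L om by rewrite ler_wpM2l.
have : 0 < tau^-1 by rewrite invr_gt0.
by lra.
Qed.

(** [Y] and the optimum may depend on the same edges; AM-GM with a free weight [lam] separates them
    into two second moments. *)
Lemma uexp_opt_ratio (Y : T -> R) (A lam : R) : 0 < lam ->
  uexp P (fun om => Y om ^+ 2) A ->
  uexp P (fun om => Y om / opt om)
    ((lam * A + ((tau ^+ 2)^-1 + opt_moment) / lam) / 2).
Proof.
move=> lam0 YA; have [L HL] := exists_layer.
have V0 : 0 <= (tau ^+ 2)^-1 / lam / 2.
  by rewrite !divr_ge0 ?invr_ge0 ?exprn_ge0 ?(ltW tau_gt0) ?(ltW lam0).
have m0 : 0 <= lam^-1 / 2 by rewrite divr_ge0 ?invr_ge0 ?(ltW lam0).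
have l0 : 0 <= lam / 2 by rewrite divr_ge0 ?(ltW lam0).
have U := uexp_le (uexpD (uexpZ l0 YA)
  (uexpD (uexp_cst P V0) (uexpZ m0 (uexp_layers L)))) (fun=> lexx _) _.
apply: (uexp_ae (measurable_nonpos_edge W) (nonpos_edge_null HW) (U _ _)).
  by rewrite le_eqVlt; apply/orP; left; apply/eqP; field; rewrite !gt_eqF.
move=> om /HL[ o0 oL].
have lay0 : 0 <= layers L om.
  by apply: sumr_ge0 => i _; rewrite mulr_ge0// divr_ge0// exprn_ge0// ltW.
have olay : (opt om ^+ 2)^-1 <= (tau ^+ 2)^-1 + layers L om.
  have t20 : 0 < (tau ^+ 2)^-1 by rewrite invr_gt0 exprn_gt0.
  have [to|] := dyadic_inv_sqr o0 tau_gt0 oL; last by rewrite -/(layers L om); lra.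
  suff : (opt om ^+ 2)^-1 <= (tau ^+ 2)^-1 by lra.
  by rewrite lef_pV2 ?posrE ?exprn_gt0// lerXn2r// nnegrE ltW.
have amgm : Y om / opt om <= lam / 2 * Y om ^+ 2 + lam^-1 / 2 * (opt om ^+ 2)^-1.
  rewrite -subr_ge0.
  have -> : lam / 2 * Y om ^+ 2 + lam^-1 / 2 * (opt om ^+ 2)^-1 - Y om / opt om
      = (lam * Y om - (opt om)^-1) ^+ 2 / (2 * lam).
    by field; rewrite !gt_eqF.
  by rewrite divr_ge0 ?sqr_ge0// mulr_ge0// ltW.
have := ler_wpM2l m0 olay; rewrite mulrDr [_ * (tau ^+ 2)^-1]mulrC mulrA.
by lra.
Qed.

End OptMoments.

(** * The algorithm *)

Section Kappa.
Context {R : realType} (n : nat).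
Variable f : 'I_n -> R.
Hypothesis f_gt0 : forall i, 0 < f i.
Hypothesis f_sorted : forall i j : 'I_n, (i <= j)%N -> f i <= f j.

Lemma kappa_le : (kappa f <= n)%N.
Proof. by apply/bigmax_leqP => j _. Qed.

Lemma kappa_attained : (1 < kappa f)%N ->
  exists2 j : 'I_n, j.+1 = kappa f & f j < j%:R^-1.
Proof.
move=> k1; have n0 : (0 < n)%N by have := kappa_le; lia.
move: k1; rewrite /kappa (@bigop.bigmax_eq_arg _ (Ordinal n0))//.
case: arg_maxnP => // j /orP[/eqP -> //|fj] _ _; by exists j.
Qed.

(** By sortedness each of the first [kappa] costs is below [1 / (kappa - 1)], and
    [kappa / (kappa - 1) <= 2]. *)
Lemma Fsum_kappa_le2 : (1 < kappa f)%N -> Fsum f (kappa f) <= 2.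
Proof.
move=> k1; have [j jk fj] := kappa_attained k1.
have j0 : (0 < j)%N by rewrite -ltnS jk.
rewrite Fsum_first_set.
apply: (@le_trans _ _ (\sum_(i in first_set n (kappa f)) j%:R^-1)).
  apply: ler_sum => i; rewrite inE -jk ltnS => ij.
  by apply: ltW; apply: le_lt_trans fj; exact: f_sorted.
rewrite sumr_const -[leLHS]mulr_natl ler_pdivrMr ?ltr0n// -natrM ler_nat.
by rewrite card_first_set ?kappa_le//; lia.
Qed.

Lemma f_lt_kappa (i : 'I_n) k : (k < kappa f)%N -> (0 < k)%N -> (i <= k)%N ->
  f i < k%:R^-1.
Proof.
move=> kk k0 ik; have [|j jk fj] := kappa_attained; first by lia.
apply: (@le_lt_trans _ _ (f j)); first by apply: f_sorted; lia.
apply: lt_le_trans fj _; rewrite lef_pV2 ?posrE ?ltr0n ?ler_nat; lia.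
Qed.

End Kappa.

(** * Second moment of the cost of the algorithm *)

Section SquareLayers.
Context {R : realType}.

(** Cauchy-Schwarz, from the nonnegativity of the sum of squared deviations from the mean. *)
Lemma sqr_sum_le (n : nat) (x : 'I_n -> R) :
  (\sum_v x v) ^+ 2 <= n%:R * \sum_v x v ^+ 2.
Proof.
case: n x => [x|n x]; first by rewrite !big_ord0 expr0n mulr0.
set S := \sum_v x v; have n0 : 0 < n.+1%:R :> R by rewrite ltr0n.
have : 0 <= \sum_v (x v - S / n.+1%:R) ^+ 2 by apply: sumr_ge0 => v _; rewrite sqr_ge0.
rewrite (eq_bigr (fun v => x v ^+ 2 - (2 * (S / n.+1%:R)) * x v + (S / n.+1%:R) ^+ 2)); last first.
  by move=> v _; ring.
rewrite big_split /= sumrB -mulr_sumr -/S sumr_const card_ord -[_ *+ _]mulr_natl.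
move=> /(ler_wpM2l (ltW n0)); rewrite mulr0 -subr_ge0 => h.
rewrite -subr_ge0; apply: le_trans h _; rewrite le_eqVlt; apply/orP; left; apply/eqP.
by field; rewrite gt_eqF.
Qed.

(** Layer decomposition on a grid of step [1 / k]: consecutive squares differ by the odd numbers
    [i.*2.+1]. *)
Lemma sqr_le_layers (x k : R) L : 0 < k -> 0 <= x -> x <= L%:R / k ->
  x ^+ 2 <= \sum_(i < L) (i.*2.+1)%:R / k ^+ 2 * (i%:R / k < x)%R%:R.
Proof.
move=> k0 x0; elim: L => [|L ih] xL.
  rewrite big_ord0 (_ : x = 0) ?expr0n//.
  by apply/eqP; rewrite eq_le x0 andbT; move: xL; rewrite mul0r.
have term0 (i : nat) : 0 <= i.*2.+1%:R / k ^+ 2 :> R.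
  by rewrite divr_ge0// exprn_ge0// ltW.
have [/ih h|Lx] := leP x (L%:R / k).
  by rewrite big_ord_recr /=; apply: le_trans h _; rewrite lerDl mulr_ge0.
rewrite (eq_bigr (fun i : 'I_L.+1 => i.*2.+1%:R / k ^+ 2)); last first.
  move=> i _; rewrite (le_lt_trans _ Lx) ?mulr1//.
  by rewrite ler_pM2r ?invr_gt0// ler_nat -ltnS.
rewrite -mulr_suml -natr_sum.
have -> : (\sum_(i < L.+1) i.*2.+1 = L.+1 ^ 2)%N.
  elim: (L.+1) => [|m ihm]; first by rewrite big_ord0.
  by rewrite big_ord_recr /= ihm; lia.
by rewrite natrX -expr_div_n lerXn2r// nnegrE divr_ge0// ltW.
Qed.

Lemma sum_layers_le L : \sum_(i < L) (i.*2.+1)%:R / 2 ^+ i <= 6 :> R.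
Proof.
suff -> : \sum_(i < L) (i.*2.+1)%:R / 2 ^+ i = 6 - (4 * L%:R + 6) / 2 ^+ L :> R.
  by rewrite gerBl divr_ge0 ?exprn_ge0// addr_ge0 ?mulr_ge0.
elim: L => [|L ih]; first by rewrite big_ord0 expr0 mulr0 add0r divr1 subrr.
have L0 : 0 < 2 ^+ L :> R by rewrite exprn_gt0.
rewrite big_ord_recr /= ih exprS -!mul2n -!natr1 natrM; field.
by rewrite gt_eqF.
Qed.

Lemma expRN_nat_le (i : nat) : expR (- i%:R) <= (2 ^+ i)^-1 :> R.
Proof.
rewrite expRN lef_pV2 ?posrE ?expR_gt0 ?exprn_gt0//.
rewrite -[i%:R]mulr1 expRM_natl lerXn2r ?nnegrE ?expR_ge0//.
by have := expR_ge1Dx (1 : R); lra.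
Qed.

End SquareLayers.

Section AlgMoment.
Context (d : measure_display) (T : measurableType d) (R : realType).
Variables (P : probability T R) (n : nat) (W : 'I_n * 'I_n -> {RV P >-> R}).
Hypothesis HW : rsp_model W.
Variable k : nat.
Hypothesis k_gt0 : (0 < k)%N.
Hypothesis k_le : (k <= n)%N.

Let wom om := edge_w (fun e => W e om).
Let U := first_set n k.

Let U_gt0 : (0 < #|U|)%N. Proof. by rewrite card_first_set. Qed.

(* A vertex outside [U] is at distance at most the minimum of [k] independent
   exponential weights. *)
Lemma uexp_conn_sqr v :
  uexp P (fun om => conn (wom om) U v ^+ 2) (6 / k%:R ^+ 2).
Proof.
have k0 : 0 < k%:R :> R by rewrite ltr0n.
have c0 : 0 <= 6 / k%:R ^+ 2 :> R by rewrite divr_ge0// exprn_ge0.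
(* Set to 0 on the null event because [uexp_series] asks for domination at every outcome. *)
pose h' om := if `[< nonpos_edge W om >] then 0 else conn (wom om) U v ^+ 2.
suff U' : uexp P h' (6 / k%:R ^+ 2).
  apply: (uexp_ae (measurable_nonpos_edge W) (nonpos_edge_null HW) U') => om om_gt0.
  by rewrite /h'; case: asboolP.
have [vU|vU] := boolP (v \in U).
  apply: (uexp_le (uexp_cst P (lexx 0))) => // om.
  rewrite /h'; case: asboolP => // /edge_gt0 om_gt0.
  by rewrite (conn_in (edge_w_gt0 om_gt0) vU) expr0n.
(* [U] consists of the first [k] vertices and [v] lies outside it, so [(u, v)] is already in
   increasing order. *)
pose J : {set 'I_n * 'I_n} := [set (u, v) | u in U]%SET.
have cJ : #|J| = k.
  by rewrite card_imset ?card_first_set// => a b [].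
have hJ e : e \in J -> (e.1 < e.2)%N.
  move=> /imsetP[u uU ->] /=; move: uU vU; rewrite !inE; lia.
(* By independence all [k] weights leave [[0, i / k]] with probability at most
   [exp(-i / k) ^ k = exp(-i) <= 2 ^ -i]. *)
pose E (i : nat) := \bigcap_(e in [set e | e \in J])
  (W e @^-1` (~` `[0, i%:R / k%:R])).
have mB (i : nat) : measurable (~` `[0, i%:R / k%:R] : set R).
  by apply: measurableC; exact: measurable_itv.
have UE (i : nat) : uexp P (fun om => i.*2.+1%:R / k%:R ^+ 2 * \1_(E i) om)
    (i.*2.+1%:R / k%:R ^+ 2 * (2 ^+ i)^-1).
  apply: uexpZ; first by rewrite divr_ge0// exprn_ge0.
  apply: uexp_indic; first exact: measurable_edges.
  apply: (@le_trans _ _ (expR (- (i%:R / k%:R)) ^+ k)%:E).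
    rewrite -[X in (_ ^+ X)%:E]cJ; apply: (edges_joint HW (expR_ge0 _) (mB i) hJ).
    by move=> e /hJ he; apply: (edge_tail HW he); rewrite divr_ge0.
  rewrite lee_fin -expRM_natl mulrN mulrCA divff ?gt_eqF// mulr1.
  exact: expRN_nat_le.
apply: (uexp_series UE) => [L|om].
  rewrite (eq_bigr (fun i : 'I_L => (i.*2.+1)%:R / 2 ^+ i / k%:R ^+ 2)); last first.
    by move=> i _; rewrite mulrAC.
  by rewrite -mulr_suml ler_wpM2r ?invr_ge0 ?exprn_ge0// sum_layers_le.
rewrite /h'; case: asboolP => [_|/edge_gt0 om_gt0].
  by exists 0%N; rewrite big_ord0.
have w_gt0 := edge_w_gt0 om_gt0.
pose x := conn (wom om) U v; have x0 : 0 <= x by exact: conn_ge0 w_gt0 _ _ U_gt0.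
exists (Num.truncn (x * k%:R)).+1.
apply: (@le_trans _ _ _ _ _ (sqr_le_layers k0 x0 _)).
  by rewrite ler_pdivlMr//; apply: ltW; exact: truncnS_gt.
apply: ler_sum => i _; rewrite ler_wpM2l ?divr_ge0 ?exprn_ge0//.
have [ix|//] := boolP (i%:R / k%:R < x)%R.
rewrite indicE mem_set// => e /= eJ; have he := hJ e eJ.
case/imsetP: eJ he => u uU -> /= uv.
have := conn_le_edge w_gt0 uU vU; rewrite -/(wom om) -/x /wom /edge_w uv => xW.
rewrite in_itv /= => /andP[_]; apply/negP; rewrite -ltNge.
exact: lt_le_trans ix xW.
Qed.

(** From [(a + b)^2 <= 2 a^2 + 2 b^2] and Cauchy-Schwarz over the [n] vertices, each contributing
    [6 / k^2]. *)
Lemma uexp_alg_sqr (f : 'I_n -> R) (A : R) : 0 <= A ->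
  0 <= Fsum f k <= A ->
  uexp P (fun om => fl_cost f (wom om) U ^+ 2)
    (2 * A ^+ 2 + 12 * n%:R ^+ 2 / k%:R ^+ 2).
Proof.
move=> A0 /andP[F0 FA].
have n20 : 0 <= 2 * n%:R :> R by rewrite mulr_ge0.
have A20 : 0 <= 2 * A ^+ 2 by rewrite mulr_ge0// exprn_ge0.
have U1 := uexpD (uexp_cst P A20) (uexpZ n20
  (uexp_sum (index_enum 'I_n) (fun v (_ : xpredT v) => uexp_conn_sqr v))).
apply: (uexp_le U1) => [om|].
  rewrite /fl_cost; set S := \sum_v _.
  rewrite -Fsum_first_set.
  have h1 : S ^+ 2 <= n%:R * \sum_v conn (wom om) U v ^+ 2 by exact: sqr_sum_le.
  have h2 : Fsum f k ^+ 2 <= A ^+ 2 by rewrite lerXn2r// nnegrE.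
  have h3 := sqr_ge0 (Fsum f k - S).
  move: h1 h2 h3; rewrite -mulrA !expr2; nra.
rewrite sumr_const card_ord -[_ *+ _]mulr_natl lerD2l le_eqVlt; apply/orP; left.
have k0 : 0 < k%:R :> R by rewrite ltr0n.
by apply/eqP; field; rewrite gt_eqF.
Qed.

End AlgMoment.

(** * Comparison with the stated bound *)

Section RhsBound.
Context {R : realType}.
Implicit Types (F : nat -> R) (n k : nat) (C : R).

(** Past the crossover [k ^ 4 * F] dominates the other summand of the denominator, which is thus at
    most [2 * k ^ 4 * F]. *)
Lemma termA_ge n k F : (0 < n)%N -> (0 < k)%N -> 0 < F (n - k)%N ->
  F (n - k)%N < k%:R ^+ 2 / n%:R ^+ 2 ->
  n%:R ^+ 4 / (2 * k%:R ^+ 4) + n%:R ^+ 2 / (2 * k%:R ^+ 3 * F (n - k)%N)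
    <= termA n k F.
Proof.
rewrite -(ltr0n R) -(ltr0n R k) /termA; move: (F _) n%:R k%:R => x a b a0 b0 x0.
rewrite ltr_pdivlMr ?exprn_gt0// => xab.
have num : 0 < a ^+ 4 * x + b * a ^+ 2.
  by rewrite addr_gt0 ?mulr_gt0 ?exprn_gt0.
have den : 0 < a ^+ 4 * x ^+ 3 + b ^+ 4 * x.
  by rewrite addr_gt0 ?mulr_gt0 ?exprn_gt0.
have -> : a ^+ 4 / (2 * b ^+ 4) + a ^+ 2 / (2 * b ^+ 3 * x)
    = (a ^+ 4 * x + b * a ^+ 2) / (2 * b ^+ 4 * x) by field; rewrite !gt_eqF.
rewrite ler_pM2l// lef_pV2 ?posrE ?mulr_gt0 ?exprn_gt0//.
have h : (x * a ^+ 2) ^+ 2 <= (b ^+ 2) ^+ 2.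
  by rewrite lerXn2r ?nnegrE ?mulr_ge0 ?exprn_ge0 ?ltW.
have := ler_wpM2l (ltW x0) h.
have -> : x * (x * a ^+ 2) ^+ 2 = a ^+ 4 * x ^+ 3 by ring.
have -> : x * (b ^+ 2) ^+ 2 = b ^+ 4 * x by ring.
have -> : 2 * b ^+ 4 * x = b ^+ 4 * x + b ^+ 4 * x by ring.
by rewrite lerD2r.
Qed.

(** The terms with [k >= 3] are dropped. As [F * n ^ 2 <= 1], the pure power of [F] dominates each
    of the two remaining denominators. *)
Lemma termB_ge n F : (3 <= n)%N -> (forall k, 0 <= F k) ->
  0 < F (n - 1)%N -> 0 < F (n - 2)%N ->
  F (n - 1)%N * n%:R ^+ 2 <= 1 -> F (n - 2)%N * n%:R ^+ 2 <= 1 ->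
  n%:R ^+ 2 / (2 * F (n - 1)%N ^+ 3) + n%:R ^+ 4 / (2 * F (n - 2)%N ^+ 2)
    <= termB n F.
Proof.
move=> n3 F0; have : 0 < n%:R :> R by rewrite ltr0n; lia.
rewrite /termB /= => a0 x0 y0 hx hy.
rewrite -[leLHS]addr0; apply: lerD; last first.
  apply: sumr_ge0 => k _; rewrite divr_ge0 ?addr_ge0 ?mulr_ge0 ?exprn_ge0//.
move: (F (n - 1)%N) (F (n - 2)%N) n%:R a0 x0 y0 hx hy => x y a a0 x0 y0 hx hy.
have one z m : 0 < z -> z * a ^+ 2 <= 1 -> (z * a ^+ 2) ^+ m <= 1.
  by move=> z0 hz; rewrite exprn_ile1// mulr_ge0 ?exprn_ge0// ltW.
apply: lerD; apply: ler_pM; rewrite ?invr_ge0 ?mulr_ge0 ?exprn_ge0 ?(ltW a0) ?(ltW x0) ?(ltW y0)//.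
- by rewrite lerDr mulr_ge0 ?exprn_ge0 ?ltW.
- rewrite lef_pV2 ?posrE ?addr_gt0 ?mulr_gt0 ?exprn_gt0//.
  rewrite mulr_natl mulr2n lerD2r.
  have -> : a ^+ 8 * x ^+ 7 = (x * a ^+ 2) ^+ 4 * x ^+ 3 by ring.
  by rewrite ler_piMl ?exprn_ge0 ?(ltW x0)// one.
- by rewrite lerDr mulr_ge0 ?exprn_ge0 ?ltW.
- rewrite lef_pV2 ?posrE ?addr_gt0 ?mulr_gt0 ?exprn_gt0//.
  rewrite mulr_natl mulr2n lerD2r.
  have -> : a ^+ 14 * y ^+ 9 = (y * a ^+ 2) ^+ 7 * y ^+ 2 by ring.
  by rewrite ler_piMl ?exprn_ge0 ?(ltW y0)// one.
Qed.

Lemma rhs_bound_ge0 C n F : 0 <= rhs_bound C n F.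
Proof. by rewrite addr_ge0 ?sqrtr_ge0. Qed.

End RhsBound.

(** * Small and large total opening cost *)

Section Regimes.
Context (d : measure_display) (T : measurableType d) (R : realType).
Variables (P : probability T R) (n : nat) (W : 'I_n * 'I_n -> {RV P >-> R}).
Hypothesis HW : rsp_model W.
Variable f : 'I_n -> R.
Hypothesis f_gt0 : forall i, 0 < f i.
Hypothesis f_sorted : forall i j : 'I_n, (i <= j)%N -> f i <= f j.
Hypothesis n_ge3 : (3 <= n)%N.

Let opt om := fl_opt f (edge_w (fun e => W e om)).
Let n_gt0 : (0 < n)%N. Proof. by lia. Qed.
Let a0 : 0 < n%:R :> R. Proof. by rewrite ltr0n. Qed.

Lemma uexp_opt_inv_small (C : R) : 64 ^+ 2 * 12 <= C ->
  Fsum f n * n%:R ^+ 2 <= 1 ->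
  uexp P (fun om => (opt om)^-1) (rhs_bound C n (Fsum f)).
Proof.
move=> hC Fn.
have F0 k : (0 < k)%N -> 0 < Fsum f k by exact: Fsum_gt0.
have Fge0 := Fsum_ge0 f_gt0.
have tau_le k : (k < 3)%N -> k != 1%N -> k != 2%N -> Fsum f n <= Fsum f (n - k).
  by case: k => [|[|[|]]]//; rewrite subn0.
have x0 : 0 < Fsum f (n - 1) by apply: F0; lia.
have y0 : 0 < Fsum f (n - 2) by apply: F0; lia.
have le_n k : Fsum f (n - k) * n%:R ^+ 2 <= 1.
  by apply: le_trans Fn; rewrite ler_wpM2r ?exprn_ge0// Fsum_le// leq_subr.
have hB := termB_ge n_ge3 Fge0 x0 y0 (le_n _) (le_n _).
set B := termB n (Fsum f) in hB *.
have X0 : 0 < n%:R ^+ 2 / Fsum f (n - 1) ^+ 3 by rewrite divr_gt0 ?exprn_gt0.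
have Y0 : 0 < n%:R ^+ 4 / Fsum f (n - 2) ^+ 2 by rewrite divr_gt0 ?exprn_gt0.
have {}hB : (n%:R ^+ 2 / Fsum f (n - 1) ^+ 3 + n%:R ^+ 4 / Fsum f (n - 2) ^+ 2) / 2 <= B.
  by apply: le_trans hB; rewrite !invfM; lra.
have B0 : 0 < B by lra.
have C0 : 0 < C by apply: lt_le_trans hC; rewrite mulr_gt0// exprn_gt0.
(* [mu] is the fourth-root term of the bound, so it remains to show that [opt_moment] is at most
   [mu ^+ 2]. *)
pose mu : R := Num.sqrt (Num.sqrt (C * B)).
have mu0 : 0 < mu by rewrite !sqrtr_gt0 mulr_gt0.
have := uexp_opt_inv HW f_gt0 f_sorted n_ge3 (F0 n n_gt0) (leqnn 3) tau_le mu0.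
move=> /uexp_le; apply => //; rewrite /rhs_bound -/B -/mu; apply: lerD.
  have -> : (Fsum f n)^-1 = Num.sqrt ((Fsum f n) ^+ 2)^-1.
    by rewrite -exprVn sqrtr_sqr ger0_norm// invr_ge0.
  by apply: ler_wsqrtr; rewrite le_max lexx.
suff h : opt_moment f (Fsum f n) 3 <= mu ^+ 2.
  have : opt_moment f (Fsum f n) 3 / mu <= mu by rewrite ler_pdivrMr// -expr2.
  by lra.
rewrite sqr_sqrtr ?sqrtr_ge0//.
pose p := n%:R ^+ 2 / Fsum f (n - 1).
pose q := n%:R ^+ 2 / Fsum f (n - 2).
have p0 : 0 <= p by rewrite divr_ge0 ?exprn_ge0 ?ltW.
have q0 : 0 <= q by rewrite divr_ge0 ?exprn_ge0 ?ltW.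
have r0 : 0 <= n%:R ^+ 4 :> R by rewrite exprn_ge0.
(* For [K = 3] the cubic coefficient is [8 * 18^3 / 9^3 = 64], and [F_n * n^2 <= 1] absorbs the
   remaining factor. *)
have om : opt_moment f (Fsum f n) 3 <= 64 * (p + q + n%:R ^+ 4).
  have le64 (z : R) (b : bool) : 0 <= z -> 8 * z * b%:R <= 64 * z.
    by move=> z0; case: b; rewrite ?mulr1 ?mulr0; lra.
  rewrite /opt_moment !mulrDr -[8 * _ / Fsum f (n - 1)]mulrA -/p.
  rewrite -[8 * _ / Fsum f (n - 2)]mulrA -/q.
  apply: lerD; first by apply: lerD; exact: le64.
  have -> : 8 * 18 ^+ 3 * (n%:R ^+ 2 / 3%:R ^+ 2) ^+ 3 * Fsum f n
      = 64 * n%:R ^+ 4 * (Fsum f n * n%:R ^+ 2) by field.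
  by rewrite ler_piMr// mulr_ge0.
have p2 : p ^+ 2 <= n%:R ^+ 2 / Fsum f (n - 1) ^+ 3.
  have -> : p ^+ 2 = n%:R ^+ 2 / Fsum f (n - 1) ^+ 3 * (Fsum f (n - 1) * n%:R ^+ 2).
    by rewrite /p; field; rewrite gt_eqF.
  by rewrite ler_piMr ?(ltW X0).
have r2 : (n%:R ^+ 4) ^+ 2 <= n%:R ^+ 2 / Fsum f (n - 1) ^+ 3.
  have -> : (n%:R ^+ 4) ^+ 2 = n%:R ^+ 2 / Fsum f (n - 1) ^+ 3
      * (Fsum f (n - 1) * n%:R ^+ 2) ^+ 3 :> R by field; rewrite gt_eqF.
  by rewrite ler_piMr ?(ltW X0)// exprn_ile1// mulr_ge0 ?exprn_ge0.
have q2 : q ^+ 2 = n%:R ^+ 4 / Fsum f (n - 2) ^+ 2.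
  by rewrite /q; field; rewrite gt_eqF.
apply: (le_trans om); rewrite -[leLHS]ger0_norm; last first.
  by rewrite mulr_ge0// !addr_ge0.
rewrite -sqrtr_sqr; apply: ler_wsqrtr.
apply: le_trans (ler_wpM2r (ltW B0) hC); rewrite exprMn -[leRHS]mulrA ler_wpM2l ?exprn_ge0//.
(* The square of the sum is at most three times the sum of squares. Two of these are bounded by the
   [F_(n-1)] term and [hB] costs a factor 2, whence [12 = 3 * 2 * 2]. *)
have h1 := sqr_ge0 (p - q); have h2 := sqr_ge0 (p - n%:R ^+ 4).
have h3 := sqr_ge0 (q - n%:R ^+ 4).
have -> : (p + q + n%:R ^+ 4) ^+ 2 = 3 * (p ^+ 2 + q ^+ 2 + (n%:R ^+ 4) ^+ 2)
  - ((p - q) ^+ 2 + (p - n%:R ^+ 4) ^+ 2 + (q - n%:R ^+ 4) ^+ 2) by ring.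
by rewrite q2; lra.
Qed.

(** At the crossover every contribution is bounded by a multiple of some [termA]:
    [176 = 32 + 16 + 128] collects [tau ^ -2] and the two cutoff terms, and [4 * 18 ^+ 3] comes from
    the cubic term. *)
Lemma opt_moment_le (M : R) (k0 : nat) : (0 < k0 < n)%N ->
  Fsum f (n - k0) < k0%:R ^+ 2 / n%:R ^+ 2 ->
  (forall k, (k < k0)%N -> k0%:R ^+ 2 / (4 * n%:R ^+ 2) <= Fsum f (n - k)) ->
  (forall k, (0 < k < n)%N -> termA n k (Fsum f) <= M) ->
  ((k0%:R ^+ 2 / (4 * n%:R ^+ 2)) ^+ 2)^-1
    + opt_moment f (k0%:R ^+ 2 / (4 * n%:R ^+ 2)) (maxn 3 k0)
    <= (176 + 4 * 18 ^+ 3) * M.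
Proof.
move=> /andP[k00 k0n] Fk0; set tau := _ / (4 * _) => tau_le hM.
have F0 k : (k < n)%N -> 0 < Fsum f (n - k).
  by move=> kn; apply: Fsum_gt0 => //; lia.
have b0 : 0 < k0%:R :> R by rewrite ltr0n.
have tA k : (0 < k < n)%N -> Fsum f (n - k) < k%:R ^+ 2 / n%:R ^+ 2 ->
    n%:R ^+ 4 / k%:R ^+ 4 <= 2 * M
    /\ n%:R ^+ 2 / Fsum f (n - k) <= 2 * k%:R ^+ 3 * M.
  move=> kpn; have [kp kn] := andP kpn.
  move=> /(termA_ge n_gt0 kp (F0 k kn)) /le_trans/(_ (hM k kpn)) hk.
  have k_gt0 : 0 < k%:R :> R by rewrite ltr0n.
  have Fk := F0 k kn.
  have h1 : 0 <= n%:R ^+ 4 / (2 * k%:R ^+ 4) :> R.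
    by rewrite divr_ge0 ?mulr_ge0 ?exprn_ge0.
  have h2 : 0 <= n%:R ^+ 2 / (2 * k%:R ^+ 3 * Fsum f (n - k)).
    by rewrite divr_ge0 ?mulr_ge0 ?exprn_ge0 ?ltW.
  split.
    have -> : n%:R ^+ 4 / k%:R ^+ 4 = 2 * (n%:R ^+ 4 / (2 * k%:R ^+ 4)) :> R.
      by field; rewrite gt_eqF.
    by rewrite ler_wpM2l//; lra.
  have -> : n%:R ^+ 2 / Fsum f (n - k) =
      2 * k%:R ^+ 3 * (n%:R ^+ 2 / (2 * k%:R ^+ 3 * Fsum f (n - k))).
    by field; rewrite !gt_eqF.
  by rewrite ler_wpM2l ?mulr_ge0 ?exprn_ge0//; lra.
have [|M1 _] := tA k0 _ Fk0; first by rewrite k00 k0n.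
have M0 : 0 <= M.
  have : 0 <= n%:R ^+ 4 / k0%:R ^+ 4 :> R by rewrite divr_ge0 ?exprn_ge0.
  by lra.
have i1 : (tau ^+ 2)^-1 <= 32 * M.
  have -> : (tau ^+ 2)^-1 = 16 * (n%:R ^+ 4 / k0%:R ^+ 4).
    by rewrite /tau; field; rewrite !gt_eqF.
  by lra.
(* This cutoff is active only for [k0 = 1], since otherwise [tau_le] applies to [k = 1]. *)
have i2 : 8 * n%:R ^+ 2 / Fsum f (n - 1) * (Fsum f (n - 1) < tau)%R%:R <= 16 * M.
  have [F1|_] := boolP (Fsum f (n - 1) < tau)%R; last by rewrite mulr0 mulr_ge0.
  have k01 : k0 = 1%N.
    apply/eqP; rewrite eqn_leq k00 andbT leqNgt; apply/negP => /tau_le; lra.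
  have [||_] := tA 1%N; [lia|by move: Fk0; rewrite k01|].
  by rewrite expr1n !mulr1 -mulrA; lra.
(* Active only for [k0 <= 2]; then [tau <= 1 / n^2], so [k = 2] also satisfies the inequality
   required by [tA]. *)
have i3 : 8 * n%:R ^+ 2 / Fsum f (n - 2) * (Fsum f (n - 2) < tau)%R%:R <= 128 * M.
  have [F2|_] := boolP (Fsum f (n - 2) < tau)%R; last by rewrite mulr0 mulr_ge0.
  have k02 : (k0 <= 2)%N by rewrite leqNgt; apply/negP => /tau_le; lra.
  have [||_] := tA 2%N; [lia| |].
    apply: lt_le_trans F2 _; rewrite /tau invfM mulrA ler_wpM2r ?invr_ge0 ?exprn_ge0//.
    have : k0%:R <= 2 :> R by rewrite ler_nat.
    by move: b0; rewrite !expr2; nra.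
  have -> : 2 * 2%:R ^+ 3 * M = 16 * M by ring.
  by rewrite mulr1 -mulrA; lra.
have i4 : 8 * 18 ^+ 3 * (n%:R ^+ 2 / (maxn 3 k0)%:R ^+ 2) ^+ 3 * tau
    <= 4 * 18 ^+ 3 * M.
  apply: (@le_trans _ _ (8 * 18 ^+ 3 * (n%:R ^+ 2 / k0%:R ^+ 2) ^+ 3 * tau)).
    have tau0 : 0 <= tau by rewrite divr_ge0 ?mulr_ge0 ?exprn_ge0.
    rewrite ler_wpM2r// ler_wpM2l ?mulr_ge0 ?exprn_ge0//.
    have m0 : 0 < (maxn 3 k0)%:R :> R by rewrite ltr0n; lia.
    apply: lerXn2r; rewrite ?nnegrE ?divr_ge0 ?exprn_ge0//.
    rewrite ler_wpM2l ?exprn_ge0// lef_pV2 ?posrE ?exprn_gt0//.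
    by rewrite lerXn2r ?nnegrE// ler_nat leq_maxr.
  have -> : 8 * 18 ^+ 3 * (n%:R ^+ 2 / k0%:R ^+ 2) ^+ 3 * tau =
      2 * 18 ^+ 3 * (n%:R ^+ 4 / k0%:R ^+ 4) :> R.
    by rewrite /tau; field; rewrite !gt_eqF.
  have -> : 4 * 18 ^+ 3 * M = 2 * 18 ^+ 3 * (2 * M) by ring.
  by rewrite ler_wpM2l// mulr_ge0// exprn_ge0.
have -> : (176 + 4 * 18 ^+ 3) * M =
    32 * M + (16 * M + 128 * M + 4 * 18 ^+ 3 * M) by ring.
by rewrite /opt_moment; apply: lerD => //; apply: lerD => //; apply: lerD.
Qed.

(* The least [k0] with [F_(n-k0) < k0^2 / n^2]; below it the opening costs
   alone already exceed the order of the optimum. *)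
Lemma exists_crossover : (3 < kappa f)%N -> 1 < Fsum f n * n%:R ^+ 2 ->
  exists k0, [/\ (0 < k0 < n)%N, Fsum f (n - k0) < k0%:R ^+ 2 / n%:R ^+ 2 &
    forall k, (k < k0)%N -> k0%:R ^+ 2 / (4 * n%:R ^+ 2) <= Fsum f (n - k)].
Proof.
move=> k3 Fn.
pose Q k := [&& (0 < k)%N, (k < n)%N & Fsum f (n - k) < k%:R ^+ 2 / n%:R ^+ 2].
have exQ : exists k, Q k.
  (* At [k = n - 1], [kappa > 3] gives [F_1 < 1/3], while [(n - 1)^2 / n^2 >= 4/9]. *)
  exists (n - 1)%N; apply/and3P; split; [lia|lia|].
  have -> : (n - (n - 1) = 1)%N by lia.
  have F1 : Fsum f 1 < 3%:R^-1.
    rewrite /Fsum (bigD1 (Ordinal n_gt0))//= big1 ?addr0.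
      exact: (f_lt_kappa f_sorted k3).
    by move=> i /andP[i1]; rewrite -val_eqE /=; lia.
  apply: lt_le_trans F1 _; rewrite ler_pdivlMr ?exprn_gt0// natrB; last lia.
  have : 3 <= n%:R :> R by rewrite ler_nat.
  by rewrite !expr2; nra.
have [k0 /and3P[k00 k0n Fk0] k0min] := ex_minnP exQ.
exists k0; split=> //; first by rewrite k00.
move=> k kk0; apply: (@le_trans _ _ (Fsum f (n - k0.-1))); last first.
  by apply: Fsum_le => //; lia.
(* The factor 4 pays for passing from [k0] to [k0 - 1], since [k0 <= 2 * (k0 - 1)] for [k0 >= 2].
   For [k0 = 1] the hypothesis on [F_n] takes over. *)
rewrite invfM mulrA ler_pdivrMr ?exprn_gt0//.
have [k01|k01] := eqVneq k0 1%N.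
  by rewrite k01 expr1n subn0; lra.
have nQ : ~~ Q k0.-1 by apply/negP => /k0min; lia.
have : k0.-1%:R ^+ 2 / n%:R ^+ 2 <= Fsum f (n - k0.-1).
  by move: nQ; rewrite /Q !negb_and -leNgt => /or3P[||//]; lia.
rewrite ler_pdivrMr ?exprn_gt0//; apply: le_trans.
have : 2 <= k0%:R :> R by rewrite ler_nat; lia.
have -> : k0.-1%:R = k0%:R - 1 :> R by rewrite -subn1 natrB.
by rewrite !expr2; nra.
Qed.

(** The [termA] part alone suffices here. [Y] will be the cost of the algorithm, or the constant 1
    when all facilities are opened. *)
Lemma uexp_ratio_large (Y : T -> R) (A C : R) : 0 <= A ->
  uexp P (fun om => Y om ^+ 2) A -> (A + (176 + 4 * 18 ^+ 3)) ^+ 2 <= C ->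
  (3 < kappa f)%N -> 1 < Fsum f n * n%:R ^+ 2 ->
  uexp P (fun om => Y om / opt om) (rhs_bound C n (Fsum f)).
Proof.
move=> A0 YA hC k3 Fn; have [k0 [k0n Fk0 tau_le]] := exists_crossover k3 Fn.
set D : R := 176 + 4 * 18 ^+ 3 in hC *.
have D0 : 0 < D by rewrite ltr_wpDr// mulr_ge0// exprn_ge0.
have C0 : 0 < C by apply: lt_le_trans hC; rewrite exprn_gt0// ltr_wpDl.
set Mx := \big[Num.max/0]_(1 <= k < n) (C * termA n k (Fsum f)).
have hM k : (0 < k < n)%N -> termA n k (Fsum f) <= Mx / C.
  move=> kn; rewrite ler_pdivlMr// mulrC.
  by apply: (@le_bigmax_seq _ _ _ _ 0 k xpredT) => //; rewrite mem_index_iota.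
have b0 : 0 < k0%:R :> R by rewrite ltr0n; lia.
set tau := k0%:R ^+ 2 / (4 * n%:R ^+ 2) in tau_le.
have tau0 : 0 < tau by rewrite divr_gt0 ?mulr_gt0 ?exprn_gt0.
have om := opt_moment_le k0n Fk0 tau_le hM; rewrite -/tau -/D in om.
have M0 : 0 < Mx / C.
  apply: lt_le_trans (hM k0 k0n).
  have F0 : 0 < Fsum f (n - k0) by apply: Fsum_gt0 => //; lia.
  by rewrite divr_gt0 ?addr_gt0 ?mulr_gt0 ?exprn_gt0.
have Mx0 : 0 < Mx by move: M0; rewrite pmulr_lgt0 ?invr_gt0.
(* This weight makes both AM-GM halves multiples of [lam]; the total is at most [lam * (A + D)],
   which is at most [sqrt Mx] by the choice of [C]. *)
pose lam := Num.sqrt (Mx / C); have lam0 : 0 < lam by rewrite sqrtr_gt0.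
(* Raising [K] to 3 only adds the indices 1 and 2, which are excluded. *)
have tau_le' k : (k < maxn 3 k0)%N -> k != 1%N -> k != 2%N -> tau <= Fsum f (n - k).
  by move=> ? ? ?; apply: tau_le; lia.
have := uexp_opt_ratio HW f_gt0 f_sorted n_ge3 tau0 (leq_maxl 3 k0) tau_le' lam0 YA.
move=> /uexp_le; apply => //.
apply: (@le_trans _ _ (Num.sqrt Mx)); last first.
  rewrite /rhs_bound -[leLHS]addr0 lerD ?sqrtr_ge0// ler_wsqrtr//.
  by rewrite le_max lexx orbT.
have lam2 : lam * lam = Mx / C by rewrite -expr2 sqr_sqrtr// ltW.
apply: (@le_trans _ _ (lam * (A + D))).
  rewrite ler_pdivrMr// [leRHS](_ : _ = lam * A * 2 + lam * D * 2); last by ring.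
  apply: lerD.
    by rewrite ler_peMr ?mulr_ge0 ?(ltW lam0)// ler1n.
  rewrite ler_pdivrMr//.
  have -> : lam * D * 2 * lam = (lam * lam) * D * 2 by ring.
  rewrite lam2; apply: le_trans om _; rewrite mulrC ler_peMr ?ler1n//.
  by rewrite mulr_ge0 ?(ltW M0) ?(ltW D0).
have AD0 : 0 <= A + D by rewrite addr_ge0// ltW.
rewrite -[A + D]ger0_norm// -sqrtr_sqr -sqrtrM ?(ltW M0)//; apply: ler_wsqrtr.
by rewrite mulrAC ler_pdivrMr// ler_wpM2l// ltW.
Qed.

(** With every vertex open the connection cost vanishes and [ALG = F_n], so only the expectation of
    [1 / OPT] has to be bounded. *)
Lemma uexp_ratio_kappa_n (C : R) :
  64 ^+ 2 * 12 <= C -> (1 + (176 + 4 * 18 ^+ 3)) ^+ 2 <= C ->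
  kappa f = n -> (3 < n)%N ->
  uexp P (fun om => fl_cost f (edge_w (fun e => W e om))
                      (first_set n (kappa f)) / opt om)
    (Fsum f n * rhs_bound C n (Fsum f)).
Proof.
move=> C1 C2 kn n3.
have Fn0 := Fsum_ge0 f_gt0 n.
suff U : uexp P (fun om => (opt om)^-1) (rhs_bound C n (Fsum f)).
  apply: (uexp_ae (measurable_nonpos_edge W) (nonpos_edge_null HW) (uexpZ Fn0 U)).
  move=> om /edge_gt0 om_gt0; rewrite kn le_eqVlt; apply/orP; left; apply/eqP.
  congr (_ * _); rewrite /fl_cost [X in _ + X]big1 ?addr0.
    by rewrite -Fsum_first_set.
  by move=> v _; apply: (conn_in (edge_w_gt0 om_gt0)); rewrite inE.
have [small|large] := leP (Fsum f n * n%:R ^+ 2) 1.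
  exact: uexp_opt_inv_small.
have U1 : uexp P (fun om : T => 1 ^+ 2) 1.
  by apply: (uexp_le (uexp_cst P ler01)) => // om; rewrite expr1n.
apply: (uexp_le (@uexp_ratio_large (fun=> 1) _ _ ler01 U1 C2 _ large)) => //.
  by rewrite kn.
by move=> om; rewrite mul1r.
Qed.

(** The largest cost is at most [F_n <= 1 / n^2 < 1 / n], so the last index qualifies. *)
Lemma kappa_full : Fsum f n * n%:R ^+ 2 <= 1 -> kappa f = n.
Proof.
move=> small; apply/eqP; rewrite eqn_leq kappa_le /=.
have n1 : (n.-1 < n)%N by lia.
apply: (@leq_trans (Ordinal n1).+1); first by rewrite /= prednK.
apply: (@leq_bigmax_cond _ _ (fun j : 'I_n => j.+1) (Ordinal n1)).
apply/orP; right => /=.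
have fn : f (Ordinal n1) <= Fsum f n.
  by rewrite /Fsum (bigD1 (Ordinal n1))//= lerDl sumr_ge0// => i _; exact: ltW.
apply: (@lt_le_trans _ _ n%:R^-1); last first.
  by rewrite lef_pV2 ?posrE ?ltr0n ?ler_nat; lia.
apply: (le_lt_trans fn); rewrite -[ltRHS]mul1r ltr_pdivlMr//.
have n2 : 1 < n%:R :> R by rewrite ltr1n; lia.
have F0 : 0 < Fsum f n by exact: Fsum_gt0.
by apply: lt_le_trans small; rewrite expr2 mulrA ltr_pMr// mulr_gt0.
Qed.

End Regimes.

Theorem theorem2 (R : realType) (f : forall n : nat, 'I_n -> R)
  (f_pos : forall n (i : 'I_n), 0 < f n i)
  (f_sorted : forall n (i j : 'I_n), (i <= j)%N -> f n i <= f n j)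
  (q : R)
  (f_ratio : forall n : nat, f n.+1 ord_max / f n.+1 ord0 <= (n.+1)%:R `^ q)
  (kappa_Theta : exists c1 c2 : R, 0 < c1 /\ 0 < c2 /\
     exists N : nat, forall n : nat, (N <= n)%N ->
       c1 * n%:R <= (kappa (f n))%:R /\ (kappa (f n))%:R <= c2 * n%:R) :
  (exists C : R, 0 < C /\ exists N : nat, forall n : nat, (N <= n)%N ->
     forall (d : measure_display) (T : measurableType d) (P : probability T R)
            (W : 'I_n * 'I_n -> {RV P >-> R}),
       rsp_model W ->
       (exp_ratio (f n) W <= (rhs_bound C n (Fsum (f n)))%:E)%E)
  /\
  ((forall n : nat, kappa (f n) = n) ->
   exists C : R, 0 < C /\ exists N : nat, forall n : nat, (N <= n)%N ->
     forall (d : measure_display) (T : measurableType d) (P : probability T R)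
            (W : 'I_n * 'I_n -> {RV P >-> R}),
       rsp_model W ->
       (exp_ratio (f n) W
          <= (Fsum (f n) n * rhs_bound C n (Fsum (f n)))%:E)%E).
Proof.
pose D : R := 176 + 4 * 18 ^+ 3.
pose C0 : R := 64 ^+ 2 * 12 + (1 + D) ^+ 2.
have D0 : 0 < D by rewrite ltr_wpDr// mulr_ge0// exprn_ge0.
have C01 : 64 ^+ 2 * 12 <= C0 by rewrite lerDl exprn_ge0// addr_ge0// ltW.
have C02 : (1 + D) ^+ 2 <= C0 by rewrite lerDr mulr_ge0// exprn_ge0.
have C0_gt0 : 0 < C0.
  by apply: lt_le_trans C01; rewrite mulr_gt0// exprn_gt0.
split; last first.
  move=> kn; exists C0; split => //; exists 4%N => n n4 d T P W HW.
  by apply: integral_le_uexp; apply: uexp_ratio_kappa_n => //; [exact: f_sorted|lia].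
have [c1 [c2 [c10 [_ [N hN]]]]] := kappa_Theta.
(* Bounds the second moment of [ALG], using [F_kappa <= 2] and [kappa >= c1 * n]. *)
pose A : R := 2 * 2 ^+ 2 + 12 / c1 ^+ 2.
have A0 : 0 <= A by rewrite addr_ge0 ?mulr_ge0 ?invr_ge0 ?exprn_ge0 ?(ltW c10).
pose C := C0 + (A + D) ^+ 2.
have AD0 : 0 <= (A + D) ^+ 2 by rewrite exprn_ge0// addr_ge0// ltW.
exists C; split; first by rewrite ltr_wpDr.
(* [n > 4 / c1] forces [kappa >= 4]. *)
exists (maxn N (maxn 4 (Num.truncn (4 / c1)).+1)) => n.
rewrite !geq_max => /and3P[/hN[kn _] n4 nt] d T P W HW.
have a0 : 0 < n%:R :> R by rewrite ltr0n; lia.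
have n3 : (3 <= n)%N by lia.
have k4 : (3 < kappa (f n))%N.
  rewrite -(ler_nat R); apply: le_trans kn; rewrite -ler_pdivrMl// mulrC.
  apply: ltW; apply: lt_le_trans (truncnS_gt _) _; by rewrite ler_nat.
apply: integral_le_uexp.
(* In the small regime [kappa = n], and the bound with the extra factor [F_n <= 1] implies the one
   without it. *)
have [small|large] := leP (Fsum (f n) n * n%:R ^+ 2) 1.
  have kf := kappa_full (f_pos n) n3 small.
  have CC1 : 64 ^+ 2 * 12 <= C by apply: le_trans C01 _; rewrite lerDl.
  have CC2 : (1 + D) ^+ 2 <= C by apply: le_trans C02 _; rewrite lerDl.
  have := uexp_ratio_kappa_n HW (f_pos n) (@f_sorted n) n3 CC1 CC2 kf n4.
  move=> /uexp_le; apply => //; rewrite ler_piMl ?rhs_bound_ge0//.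
  apply: le_trans small; rewrite ler_peMr//.
    exact: Fsum_ge0.
  by rewrite exprn_ege1// ler1n; lia.
have k0 : 0 < (kappa (f n))%:R :> R by rewrite ltr0n; lia.
have kp : (0 < kappa (f n))%N by lia.
apply: (uexp_ratio_large HW (f_pos n) (@f_sorted n) n3 A0) => //.
  have F2 : 0 <= Fsum (f n) (kappa (f n)) <= 2.
    apply/andP; split; first exact: Fsum_ge0.
    by apply: Fsum_kappa_le2 => //; [exact: f_sorted|lia].
  have := uexp_alg_sqr HW kp (kappa_le (f n)) (ler0n R 2) F2.
  move=> /uexp_le; apply => //; rewrite lerD2l -mulrA ler_wpM2l//.
  rewrite ler_pdivrMr ?exprn_gt0// mulrC ler_pdivlMr ?exprn_gt0//.
  by rewrite -exprMn mulrC lerXn2r// nnegrE// mulr_ge0// ltW.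
by rewrite /C -/D lerDr ltW.
Qed.
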